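(* Let $p\in(0,\frac12)$. (i) For all $\lambda\in(\beta_1^{-1},g)$, $$d(\nu_\lambda^p,x)=\frac{\log p+\log(1-p)}{2\log\lambda}\quad\text{for all }x\in\widetilde{\mathcal A}_\lambda.$$ (ii) For all $\lambda\in(\frac12,\beta_1^{-1})$ there exists $r_\lambda\in(0,\frac12)$ such that $$\dim_H\{x\in\widetilde{\mathcal A}_\lambda:\ d(\nu_\lambda^p,x)=\gamma\}>0$$ for all $$\gamma\in\left[\frac{r_\lambda\log p+(1-r_\lambda)\log(1-p)}{\log\lambda},\ \frac{(1-r_\lambda)\log p+r_\lambda\log(1-p)}{\log\lambda}\right].$$ Moreover, $r_\lambda\searrow0$ as $\lambda\searrow\frac12$. (iii) For all $\lambda\in(\frac12,\beta_1^{-1})$, $$\dim_H\{x\in\widetilde{\mathcal A}_\lambda:\ \underline d(\nu_\lambda^p,x)<\overline d(\nu_\lambda^p,x)\}>0 .$$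
   Context: For $\lambda,p\in(0,1)$, $\nu_\lambda^p$ denotes the $p$-biased Bernoulli convolution: the distribution of the random series $\sum_{n\ge1}i_n\lambda^n$, where the $i_n$ are i.i.d. taking values $0,1$ with probabilities $p,1-p$. $I_\lambda=[0,\frac{\lambda}{1-\lambda}]$. The local dimension of a measure $\mu$ on $\mathbb R$ at $x$ is $d(\mu,x)=\lim_{r\searrow0}\frac{\log\mu(B(x,r))}{\log r}$, provided the limit exists (with $B(x,r)$ the open ball). $\underline d(\mu,x)$ and $\overline d(\mu,x)$ are the corresponding $\liminf$ and $\limsup$. $\dim_H$ is Hausdorff dimension. $g=\frac{\sqrt5-1}{2}$. $\beta_1$ is the positive solution of $1=x^{-1}+\sum_{n=1}^\infty x^{-2n}$; $\beta_1^{-1}=0.554958\ldots$. Definition of $\widetilde{\mathcal A}_\lambda$ for $\lambda\in(\frac12,1)$: Let $\mathcal A_\lambda$ be the set of $x\in I_\lambda$ for which there is exactly one sequence $(a_n)_{n\ge1}\in\{0,1\}^{\mathbb N}$ with $x=\sum_{n\ge1}a_n\lambda^n$. Let $\beta=\lambda^{-1}$, $C_\lambda=[\lambda,\frac{\lambda^2}{1-\lambda}]$, and let $F_\beta:I_\lambda\setminus C_\lambda\to I_\lambda$ be given by $F_\beta(x)=\beta x$ for $x\in[0,\lambda)$ and $F_\beta(x)=\beta x-1$ for $x\in(\frac{\lambda^2}{1-\lambda},\frac{\lambda}{1-\lambda}]$. The whole orbit $\{F_\beta^n x\}_{n\ge0}$ is defined if and only if $x\in\mathcal A_\lambda$. For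 $\delta>0$ put $\widetilde{\mathcal A}_{\lambda,\delta}=\{x\in\mathcal A_\lambda:\operatorname{dist}(\{F_\beta^n x\}_{n\ge0},C_\lambda)\ge\delta\}$, and $\widetilde{\mathcal A}_\lambda=\bigcup_{\delta>0}\widetilde{\mathcal A}_{\lambda,\delta}$.
   Formalization: In (i) the end points x=0 and x=λ/(1−λ) are excluded: they belong to Ã_λ, but the local dimensions there are log p/log λ and log(1−p)/log λ, so the stated formula fails at them. *)

(* Defs.v *)
From HB Require Import structures.
From mathcomp Require Import all_boot all_order all_algebra.
From mathcomp Require Import all_classical all_reals all_analysis.

Set Implicit Arguments.
Unset Strict Implicit.
Unset Printing Implicit Defensive.

Import Order.TTheory GRing.Theory Num.Theory.
Import numFieldNormedType.Exports.

Local Open Scope classical_set_scope.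
Local Open Scope ring_scope.

(* The digit sequence (a_n)_{n >= 1} is indexed from 0 here: a n is the digit
   a_{n+1} and carries the weight l^(n+1). *)
Definition expansion (R : realType) (l : R) (a : nat -> bool) : R :=
  limn (series (fun n => (a n)%:R * l ^+ n.+1)).

Definition mutually_independent d d' (T : measurableType d)
    (T' : measurableType d') (R : realType) (P : probability T R)
    (X : nat -> {RV P >-> T'}) : Prop :=
  forall (J : seq nat) (B : nat -> set T'),
    uniq J -> (forall j, measurable (B j)) ->
    P (\bigcap_(j in [set` J]) (X j @^-1` B j)) =
      (\prod_(j <- J) P (X j @^-1` B j))%E.

(* i.i.d. digits: 0 (false) with probability p, 1 (true) with probability
   1 - p. *)
Definition iid_digits (R : realType) (p : R) d (T : measurableType d)
    (P : probability T R) (i : nat -> {RV P >-> bool}) : Prop :=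
  [/\ mutually_independent i,
      forall n, P (i n @^-1` [set false]) = p%:E &
      forall n, P (i n @^-1` [set true]) = (1 - p)%:E].

Definition bernoulli_convolution (R : realType) (l p : R)
    (nu : probability R R) : Prop :=
  exists (d : measure_display) (T : measurableType d) (P : probability T R)
         (i : nat -> {RV P >-> bool}),
    iid_digits p i /\
    forall A : set R, measurable A ->
      nu A = pushforward P (fun t => expansion l (fun n => i n t)) A.

(* Computed in \bar R, so that log 0 = -oo and the quotient is +oo for
   0 < r < 1 when the ball is null. *)
Definition dim_ratio (R : realType) (mu : probability R R) (x r : R) : \bar R :=
  (lne (mu (ball x r)) * ((ln r)^-1)%:E)%E.

(* "d(mu, x) = gamma": the limit exists and equals gamma. *)
Definition has_local_dim (R : realType) (mu : probability R R) (x gamma : R)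
    : Prop :=
  dim_ratio mu x r @[r --> 0^'+] --> gamma%:E.

Definition lower_local_dim (R : realType) (mu : probability R R) (x : R)
    : \bar R :=
  limf_einf (dim_ratio mu x) (0 : R)^'+.

Definition upper_local_dim (R : realType) (mu : probability R R) (x : R)
    : \bar R :=
  limf_esup (dim_ratio mu x) (0 : R)^'+.

Definition diam (R : realType) (U : set R) : \bar R :=
  ereal_sup [set `|y.1 - y.2|%:E | y in U `*` U].

Definition diam_pow (R : realType) (s : R) (U : set R) : \bar R :=
  if U == set0 then 0%E else (diam U `^ s)%E.

Definition hausdorff_premeasure (R : realType) (s delta : R) (A : set R)
    : \bar R :=
  ereal_inf [set (\sum_(0 <= k <oo) diam_pow s (U k))%E | U in
    [set U : nat -> set R | A `<=` \bigcup_k U k /\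
                            forall k, (diam (U k) <= delta%:E)%E]].

Definition hausdorff_measure (R : realType) (s : R) (A : set R) : \bar R :=
  ereal_sup [set hausdorff_premeasure s delta A | delta in
    [set delta : R | 0 < delta]].

Definition hausdorff_dim (R : realType) (A : set R) : \bar R :=
  ereal_inf [set s%:E | s in
    [set s : R | 0 <= s /\ hausdorff_measure s A = 0%E]].

Definition Ilam (R : realType) (l : R) : set R := `[0, l / (1 - l)].

Definition Clam (R : realType) (l : R) : set R := `[l, l ^+ 2 / (1 - l)].

Definition univoque (R : realType) (l : R) : set R :=
  [set x | Ilam l x /\ exists! a : nat -> bool, x = expansion l a].

(* F_beta is only meant on Ilam l `\` Clam l; elsewhere this total function
   takes irrelevant values, since it is only iterated from points of
   univoque l, whose orbits stay in Ilam l `\` Clam l. *)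
Definition Fbeta (R : realType) (l x : R) : R :=
  if x < l then l^-1 * x else l^-1 * x - 1.

Definition set_dist (R : realType) (A B : set R) : R :=
  inf [set `|y.1 - y.2| | y in A `*` B].

Definition univoque_away (R : realType) (l delta : R) : set R :=
  [set x | univoque l x /\
           delta <= set_dist (range (fun n => iter n (Fbeta l) x)) (Clam l)].

Definition Atilde (R : realType) (l : R) : set R :=
  \bigcup_(delta in [set delta : R | 0 < delta]) univoque_away l delta.

Definition golden (R : realType) : R := (Num.sqrt 5 - 1) / 2.

(* Convergence of the series is part of the equation: for |b| <= 1 the series
   diverges and its limn would be a junk value. *)
Definition is_beta1 (R : realType) (b : R) : Prop :=
  0 < b /\
  (b^-1 + \sum_(1 <= n < N.+1) (b ^+ (2 * n))^-1) @[N --> \oo] --> (1 : R).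

(* Main.v *)
(** If the orbit of [x] stays at distance at least [delta] from the switch region
    [Clam l], then every point within [delta * l ^+ n] of [x] has the same first
    [n] digits. Hence the mass of a ball of radius comparable to [l ^+ n] around
    [x] is comparable to the product of the weights of the first [n] digits, and
    the local dimension at [x] only depends on the digit frequencies of [x].

    For [l] above [beta1^-1], a digit 0 cannot be followed by [11(01)^j1], nor a
    digit 1 by the mirror image: double digits 11 and 00 alternate, so the numbers
    of ones and zeros among the first [n] digits differ by a bounded amount. For
    [l] below [beta1^-1], all concatenations of [1^N(10)^k] and [0^N(10)^k], for
    suitable [N] and [k], have orbits uniformly away from [Clam l]. Part of the
    choices of words is used to tune the frequency of ones, and the rest is left
    free: it spans a Cantor set that maps onto [[0, 1]] by a Hoelder map, so its
    Hausdorff dimension is positive. *)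

Require Import Defs.
From mathcomp Require Import all_boot all_order all_algebra.
From mathcomp Require Import all_classical all_reals all_analysis measurable_realfun.
From mathcomp Require Import ring lra zify.
Set Implicit Arguments.
Unset Strict Implicit.
Unset Printing Implicit Defensive.

Import Order.TTheory GRing.Theory Num.Theory.
Import numFieldNormedType.Exports.
Local Open Scope classical_set_scope.
Local Open Scope ring_scope.

(** * Expansions and digit sequences *)

Definition tailn (n : nat) (a : nat -> bool) : nat -> bool := fun i => a (n + i)%N.

Lemma tailn0 (a : nat -> bool) : tailn 0 a = a.
Proof. by []. Qed.

Lemma tailn_tailn (m n : nat) (a : nat -> bool) :
  tailn m (tailn n a) = tailn (n + m) a.
Proof. by apply/funext => i; rewrite /tailn addnA. Qed.

Lemma is_cvg_digits (R : realType) (l : R) (a : nat -> bool) : 0 < l < 1 ->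
  cvgn (series (fun n => (a n)%:R * l ^+ n.+1)).
Proof.
move=> /andP[l0 l1].
apply: (@series_le_cvg R _ (geometric l l)).
- by move=> n; rewrite mulr_ge0// ?ler0n// exprn_ge0// ltW.
- by move=> n; rewrite /= mulr_ge0// ?exprn_ge0// ltW.
- move=> n; rewrite /= -exprS ler_piMl// ?exprn_ge0// ?(ltW l0)//.
  by case: (a n).
- by apply: is_cvg_geometric_series; rewrite ger0_norm// ltW.
Qed.

Lemma cvg_expansion (R : realType) (l : R) (a : nat -> bool) : 0 < l < 1 ->
  series (fun n => (a n)%:R * l ^+ n.+1) n @[n --> \oo] --> expansion l a.
Proof. by move=> hl; exact: is_cvg_digits. Qed.

Lemma expansionE (R : realType) (l : R) (a : nat -> bool) : 0 < l < 1 ->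
  expansion l a = l * ((a 0%N)%:R + expansion l (tailn 1 a)).
Proof.
move=> hl; apply/(@cvg_lim _ _ _ _ _ (series _)) => //.
rewrite -cvg_shiftS.
have -> : [sequence series (fun n => (a n)%:R * l ^+ n.+1) n.+1]_n =
  (fun n => l * ((a 0%N)%:R +
     series (fun n => (tailn 1 a n)%:R * l ^+ n.+1) n)).
  apply/funext => n; rewrite /series/= big_nat_recl//= expr1 mulrDr mulrC.
  congr (_ + _); rewrite big_distrr/=; apply: eq_bigr => i _.
  by rewrite /tailn add1n [in LHS]exprS mulrCA.
apply: cvgMr; apply: cvgD; first exact: cvg_cst.
exact: cvg_expansion.
Qed.

Lemma expansion_tailn (R : realType) (l : R) (a : nat -> bool) (n : nat) :
  0 < l < 1 ->
  expansion l (tailn n a) = l * ((a n)%:R + expansion l (tailn n.+1 a)).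
Proof.
by move=> hl; rewrite expansionE// tailn_tailn addn1 /tailn addn0.
Qed.

(** Letting the base vary along with the digits is what makes admissibility of words, and hence
    [freq_bound], monotone in [l]. *)
Lemma le_expansion (R : realType) (l l' : R) (a b : nat -> bool) :
  0 < l -> l <= l' -> l' < 1 -> (forall n, a n -> b n) ->
  expansion l a <= expansion l' b.
Proof.
move=> l0 ll' l'1 ab.
have hl : 0 < l < 1 by rewrite l0 (le_lt_trans ll').
have hl' : 0 < l' < 1 by rewrite (lt_le_trans l0).
apply: ler_lim; [exact: is_cvg_digits|exact: is_cvg_digits|].
apply: nearW => n; apply: ler_sum => i _.
apply: ler_pM; rewrite ?ler0n ?exprn_ge0 ?(ltW l0)//.
  by have := ab i; case: (a i) => // ->.
by rewrite lerXn2r// nnegrE ltW//; case/andP: hl'.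
Qed.

Lemma expansion_true (R : realType) (l : R) : 0 < l < 1 ->
  expansion l (fun=> true) = l / (1 - l).
Proof.
move=> /[dup] hl /andP[l0 l1].
have := expansionE (fun=> true) hl; rewrite /tailn /=.
set x := expansion _ _ => h; apply/(@mulIf _ (1 - l)); first lra.
by rewrite mulfVK; lra.
Qed.

Lemma expansion_false (R : realType) (l : R) : 0 < l < 1 ->
  expansion l (fun=> false) = 0.
Proof.
move=> /[dup] hl /andP[l0 l1].
have := expansionE (fun=> false) hl; rewrite /tailn /= add0r.
set x := expansion _ _ => h.
by apply/(@mulIf _ (1 - l)); first lra; rewrite mul0r; lra.
Qed.

Lemma expansion_ge0 (R : realType) (l : R) (a : nat -> bool) : 0 < l < 1 ->
  0 <= expansion l a.
Proof.
move=> /[dup] hl /andP[l0 l1]; rewrite -(@expansion_false R l)//.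
exact: le_expansion.
Qed.

Lemma expansion_le (R : realType) (l : R) (a : nat -> bool) : 0 < l < 1 ->
  expansion l a <= l / (1 - l).
Proof.
move=> /[dup] hl /andP[l0 l1]; rewrite -(@expansion_true R l)//.
exact: le_expansion.
Qed.

Definition flip (a : nat -> bool) : nat -> bool := fun n => ~~ a n.

Lemma expansion_flip (R : realType) (l : R) (a : nat -> bool) : 0 < l < 1 ->
  expansion l (flip a) = l / (1 - l) - expansion l a.
Proof.
move=> hl; rewrite -(@expansion_true R l)//.
apply/(@cvg_lim _ _ _ _ _ (series _)) => //.
have -> : series (fun n => (flip a n)%:R * l ^+ n.+1) =
  (series (fun n => true%:R * l ^+ n.+1)) -
  (series (fun n => (a n)%:R * l ^+ n.+1)).
  apply/funext => n; rewrite fctE /series/= -sumrB; apply: eq_bigr => i _.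
  by rewrite /flip; case: (a i); rewrite /= mul0r mul1r ?subrr ?subr0.
by apply: cvgB; exact: cvg_expansion.
Qed.

Lemma expansion_prefix (R : realType) (l : R) (a b : nat -> bool) (n : nat) :
  0 < l < 1 -> (forall i, (i < n)%N -> a i = b i) ->
  `|expansion l a - expansion l b| <= l ^+ n * (l / (1 - l)).
Proof.
move=> /[dup] hl /andP[l0 l1]; elim: n a b => [|n IH] a b ab.
  have := expansion_ge0 a hl; have := expansion_le a hl.
  have := expansion_ge0 b hl; have := expansion_le b hl.
  by rewrite expr0 mul1r ler_distl; lra.
rewrite (expansionE a)// (expansionE b)// ab//.
rewrite -mulrBr opprD addrACA subrr add0r normrM (gtr0_norm l0).
rewrite exprS -mulrA ler_pM2l//.
by apply: IH => i ni; exact: ab.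
Qed.

(** The digit-side form of [univoque_away]: the value of [tailn n a] is the n-th point of the orbit,
    and digit 1 or 0 tells on which side of [Clam l] it lies. *)
Definition gapped (R : realType) (l delta : R) (a : nat -> bool) : Prop :=
  forall n, if a n then l ^+ 2 / (1 - l) + delta <= expansion l (tailn n a)
            else expansion l (tailn n a) <= l - delta.

Lemma gappedS (R : realType) (l delta : R) (a : nat -> bool) (n : nat) :
  gapped l delta a -> gapped l delta (tailn n a).
Proof. by move=> h m; rewrite tailn_tailn; exact: h. Qed.

Lemma expansion_digit1 (R : realType) (l : R) (a : nat -> bool) : 0 < l < 1 ->
  a 0%N -> l <= expansion l a.
Proof.
move=> /[dup] hl /andP[l0 _] a0; rewrite expansionE// a0 mulrDr mulr1.
by rewrite lerDl mulr_ge0 ?(ltW l0)// expansion_ge0.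
Qed.

Lemma expansion_digit0 (R : realType) (l : R) (a : nat -> bool) : 0 < l < 1 ->
  ~~ a 0%N -> expansion l a <= l ^+ 2 / (1 - l).
Proof.
move=> /[dup] hl /andP[l0 _] /negPf a0; rewrite expansionE// a0 add0r.
by rewrite expr2 -mulrA ler_pM2l// expansion_le.
Qed.

(** A first digit 0 gives a value at most [l ^+ 2 / (1 - l)], a first digit 1 a value at least [l];
    a point [delta]-close to a gapped value therefore has the same first digit. Removing this common
    digit divides distances by [l], which gives the induction. *)
Lemma gapped_digits (R : realType) (l delta : R) (a b : nat -> bool)
    (n : nat) :
  0 < l < 1 -> 0 < delta -> gapped l delta a ->
  `|expansion l a - expansion l b| < delta * l ^+ n ->
  forall i, (i <= n)%N -> a i = b i.
Proof.
move=> /[dup] hl /andP[l0 l1] d0.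
have key (x y : nat -> bool) : gapped l delta x ->
    `|expansion l x - expansion l y| < delta -> x 0%N = y 0%N.
  move=> sx; rewrite ltr_distl => /andP[h1 h2].
  have := sx 0%N; rewrite tailn0; case: ifPn => x0 h.
    apply/esym; apply: contraT => y0.
    by have := expansion_digit0 hl y0; lra.
  apply/esym; apply: contraNF x0 => y0.
  by have := expansion_digit1 hl y0; lra.
elim: n a b => [|n IH] a b sa; first by rewrite mulr1 => h [|//] _; exact: key.
move=> h.
have ab0 : a 0%N = b 0%N.
  apply: key => //; apply: (lt_le_trans h).
  by rewrite ler_piMr ?(ltW d0)// exprn_ile1// ltW.
case=> [|i] ni //.
apply: (IH (tailn 1 a) (tailn 1 b)) => //; first exact: gappedS.
move: h; rewrite (expansionE a)// (expansionE b)// ab0.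
rewrite -mulrBr opprD addrACA subrr add0r normrM (gtr0_norm l0).
by rewrite exprS mulrCA ltr_pM2l.
Qed.

Lemma Clam_ends (R : realType) (l : R) : 1 / 2 < l < 1 ->
  l <= l ^+ 2 / (1 - l).
Proof.
by move=> /andP[l0 l1]; rewrite ler_pdivlMr; [nra|lra].
Qed.

Lemma Fbeta_expansion (R : realType) (l delta : R) (a : nat -> bool) (n : nat) :
  1 / 2 < l < 1 -> 0 < delta -> gapped l delta a ->
  Fbeta l (expansion l (tailn n a)) = expansion l (tailn n.+1 a).
Proof.
move=> /[dup] hl /andP[l0 l1] d0 sa.
have hl' : 0 < l < 1 by lra.
have ends := Clam_ends hl.
have ln0 : l != 0 by lra.
have := sa n; have := expansion_tailn a n hl'; rewrite /Fbeta.
case: (a n) => -> /= h.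
  by rewrite ltNge (_ : l <= _) /=; [rewrite mulKf//; lra|lra].
by rewrite (_ : _ < l) /=; [rewrite mulKf//; lra|lra].
Qed.

Lemma gapped_univoque_away (R : realType) (l delta : R) (a : nat -> bool) :
  1 / 2 < l < 1 -> 0 < delta -> gapped l delta a ->
  univoque_away l delta (expansion l a).
Proof.
move=> /[dup] hl /andP[l0 l1] d0 sa.
have hl' : 0 < l < 1 by lra.
have ends := Clam_ends hl.
have iterE n : iter n (Fbeta l) (expansion l a) = expansion l (tailn n a).
  by elim: n => [|n IH]//=; rewrite IH (Fbeta_expansion _ hl d0 sa).
split.
  split; first by rewrite /Ilam /= in_itv /= expansion_ge0 ?expansion_le.
  exists a; split=> // b ab; apply/funext => n.
  apply: (gapped_digits (n := n) hl' d0 sa) => //.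
  by rewrite ab subrr normr0 mulr_gt0// exprn_gt0//; lra.
(* Nonemptiness matters: [inf] of the empty set is 0, which is below [delta]. *)
apply: lb_le_inf.
  exists `|expansion l a - l|, (expansion l a, l) => //; split => /=.
    by exists 0%N.
  by rewrite /Clam /= in_itv/= lexx.
move=> w [[y z] /= [[n _ <-]]]; rewrite /Clam /= in_itv /= => /andP[z1 z2] <-.
rewrite iterE.
have := sa n; case: (a n) => h.
  by rewrite ger0_norm; lra.
by rewrite ler0_norm; lra.
Qed.

Lemma univoque_away_gapped (R : realType) (l delta x : R) :
  1 / 2 < l < 1 -> 0 < delta -> univoque_away l delta x ->
  exists2 a, x = expansion l a & gapped l delta a.
Proof.
move=> /[dup] hl /andP[l0 l1] d0 [[_ [a [xa _]]] hd].
have hl' : 0 < l < 1 by lra.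
have ends := Clam_ends hl.
have away n z : l <= z <= l ^+ 2 / (1 - l) ->
    delta <= `|iter n (Fbeta l) x - z|.
  move=> hz; apply: (le_trans hd); apply: ge_inf.
    by exists 0 => _ [y _ <-].
  by exists (iter n (Fbeta l) x, z) => //=; split => /=;
    [exists n|rewrite /Clam/= in_itv].
(* The digit tells which end of [Clam l] bounds the orbit point from one side. The point is not in
   [Clam l], being at distance 0 from itself, so it lies beyond the other end, at distance at least
   [delta]. *)
have side n : iter n (Fbeta l) x = expansion l (tailn n a) ->
    if a n then l ^+ 2 / (1 - l) + delta <= expansion l (tailn n a)
    else expansion l (tailn n a) <= l - delta.
  move=> itn.
  have far z : l <= z <= l ^+ 2 / (1 - l) ->
    delta <= `|expansion l (tailn n a) - z| by move=> /away-/(_ n); rewrite itn.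
  set t := expansion _ _ in far *.
  have out : ~ (l <= t <= l ^+ 2 / (1 - l)).
    by move=> /far; rewrite subrr normr0; lra.
  case: ifPn => an.
    have t1 : l <= t by apply: expansion_digit1 => //; rewrite /tailn addn0.
    have := far (l ^+ 2 / (1 - l)); rewrite ends lexx => /(_ isT).
    case: (leP t (l ^+ 2 / (1 - l))) => t2; first by exfalso; apply: out; lra.
    by rewrite ger0_norm; lra.
  have t1 : t <= l ^+ 2 / (1 - l).
    by apply: expansion_digit0 => //; rewrite /tailn addn0.
  have := far l; rewrite ends lexx => /(_ isT).
  case: (leP l t) => t2; first by exfalso; apply: out; lra.
  by rewrite ltr0_norm; lra.
exists a => // n; apply: (side).
elim: n => [//|n IH]; rewrite iterS IH.
have := side _ IH; have := expansion_tailn a n hl'; rewrite /Fbeta.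
have ln0 : l != 0 by lra.
case: (a n) => -> /= h.
  by rewrite ltNge (_ : l <= _) /=; [rewrite mulKf//; lra|lra].
by rewrite (_ : _ < l) /=; [rewrite mulKf//; lra|lra].
Qed.

(** * Masses of cylinders and balls *)

Definition digit_weight (R : realType) (p : R) (b : bool) : R :=
  if b then 1 - p else p.

Definition log_mass (R : realType) (p : R) (a : nat -> bool) (n : nat) : R :=
  \sum_(i < n) ln (digit_weight p (a i)).

Lemma digit_weight_gt0 (R : realType) (p : R) b : 0 < p < 1 ->
  0 < digit_weight p b.
Proof. by move=> hp; case: b; rewrite /digit_weight; lra. Qed.

Lemma expR_log_mass (R : realType) (p : R) (a : nat -> bool) (n : nat) :
  0 < p < 1 ->
  \prod_(i < n) digit_weight p (a i) = expR (log_mass p a n).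
Proof.
move=> hp; rewrite /log_mass expR_sum; apply: eq_bigr => i _.
by rewrite lnK// posrE digit_weight_gt0.
Qed.


Lemma measurable_expansion (R : realType) (l : R) d (T : measurableType d)
    (P : probability T R) (i : nat -> {RV P >-> bool}) : 0 < l < 1 ->
  measurable_fun setT (fun t => expansion l (fun n => i n t)).
Proof.
move=> hl.
apply: (@measurable_fun_cvg _ _ _ _
  (fun n t => series (fun n => (i n t)%:R * l ^+ n.+1) n)) => //; last first.
  by move=> t _; exact: cvg_expansion.
move=> n; rewrite /series /=.
apply: measurable_sum => j.
have mf : measurable_fun setT (fun b : bool => b%:R * l ^+ j.+1 : R) by [].
exact: (measurableT_comp mf).
Qed.

Lemma cylinder_mass (R : realType) (p : R) d (T : measurableType d)
    (P : probability T R) (i : nat -> {RV P >-> bool}) (a : nat -> bool) n :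
  0 < p < 1 -> iid_digits p i ->
  P (\bigcap_(j in [set` iota 0 n]) (i j @^-1` [set a j])) =
  (expR (log_mass p a n))%:E.
Proof.
move=> hp [ind P0 P1]; rewrite ind ?iota_uniq//.
rewrite -expR_log_mass// -(big_mkord xpredT (fun j => digit_weight p (a j))).
rewrite /index_iota subn0 -prodEFin; apply: eq_bigr => j _.
by rewrite /digit_weight; case: (a j); [exact: P1|exact: P0].
Qed.

Lemma measurable_cylinder (R : realType) d (T : measurableType d)
    (P : probability T R) (i : nat -> {RV P >-> bool}) (a : nat -> bool) n :
  measurable (\bigcap_(j in [set` iota 0 n]) (i j @^-1` [set a j])).
Proof.
apply: bigcap_measurableType => j _.
by rewrite -[X in measurable X]setTI; exact: measurable_funP.
Qed.

(** By [gapped_digits], every sequence with value in the ball lies in the cylinder of the first [n]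
    digits of [a]. *)
Lemma nu_ball_le (R : realType) (l p delta r : R) (nu : probability R R)
    (a : nat -> bool) (n : nat) :
  0 < l < 1 -> 0 < p < 1 -> bernoulli_convolution l p nu -> 0 < delta ->
  gapped l delta a -> r <= delta * l ^+ n ->
  (nu (ball (expansion l a) r) <= (expR (log_mass p a n))%:E)%E.
Proof.
move=> hl hp [d [T [P [i [iid nuE]]]]] d0 ga rn.
have mb := measurable_ball (expansion l a) r.
rewrite nuE// /pushforward -(cylinder_mass a n hp iid).
apply: le_measure; rewrite ?inE.
- by rewrite -[X in measurable X]setTI; exact: measurable_expansion.
- exact: measurable_cylinder.
- move=> t /= ht j /=; rewrite mem_iota add0n => /= jn.
  apply/esym; apply: (gapped_digits (b := fun k => i k t) hl d0 ga _ (ltnW jn)).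
  exact: lt_le_trans ht rn.
Qed.

(** Conversely, all sequences of the cylinder have their values in the ball, by
    [expansion_prefix]. *)
Lemma nu_ball_ge (R : realType) (l p r : R) (nu : probability R R)
    (a : nat -> bool) (n : nat) :
  0 < l < 1 -> 0 < p < 1 -> bernoulli_convolution l p nu ->
  l ^+ n * (l / (1 - l)) < r ->
  ((expR (log_mass p a n))%:E <= nu (ball (expansion l a) r))%E.
Proof.
move=> hl hp [d [T [P [i [iid nuE]]]]] rn.
have mb := measurable_ball (expansion l a) r.
rewrite nuE// /pushforward -(cylinder_mass a n hp iid).
apply: le_measure; rewrite ?inE.
- exact: measurable_cylinder.
- by rewrite -[X in measurable X]setTI; exact: measurable_expansion.
- move=> t /= ht; apply: le_lt_trans rn; apply: expansion_prefix => // j jn.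
  by apply/esym; apply: ht => /=; rewrite mem_iota.
Qed.

(** * Local dimension and digit frequencies *)

Lemma dim_ratio_ge (R : realType) (nu : probability R R) (x r X : R) :
  0 < r < 1 -> (nu (ball x r) <= (expR (X * ln r))%:E)%E ->
  (X%:E <= dim_ratio nu x r)%E.
Proof.
move=> /[dup] hr /andP[r0 r1].
have lr : ln r < 0 by rewrite ln_lt0.
have mb := measurable_ball x r.
have m0 := measure_ge0 nu (ball x r).
rewrite /dim_ratio -(fineK (fin_num_measure nu _ mb)) lee_fin.
have := fine_ge0 m0; set m := fine _; rewrite le_eqVlt => /predU1P[<- _|mp h].
  (* For a null ball the ratio is [-oo] times a negative number, that is [+oo]. *)
  by rewrite le0_lneNy// mulNyr sgrV// ltr0_sg// mulN1e leey.
rewrite lne_EFin// -EFinM lee_fin ler_ndivlMr//.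
by rewrite -ler_expR lnK.
Qed.

Lemma dim_ratio_le (R : realType) (nu : probability R R) (x r X : R) :
  0 < r < 1 -> ((expR (X * ln r))%:E <= nu (ball x r))%E ->
  (dim_ratio nu x r <= X%:E)%E.
Proof.
move=> /[dup] hr /andP[r0 r1].
have lr : ln r < 0 by rewrite ln_lt0.
have mb := measurable_ball x r.
rewrite /dim_ratio -(fineK (fin_num_measure nu _ mb)) lee_fin.
set m := fine _ => h.
have mp : 0 < m by apply: lt_le_trans h; exact: expR_gt0.
rewrite lne_EFin// -EFinM lee_fin ler_ndivrMr//.
by rewrite -ler_expR lnK.
Qed.

Lemma exists_scale (R : realType) (l c r : R) : 0 < l < 1 -> 0 < r <= c ->
  exists n, c * l ^+ n.+1 < r <= c * l ^+ n.
Proof.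
move=> /andP[l0 l1] /andP[r0 rc].
have c0 : 0 < c by lra.
have ex : exists n, c * l ^+ n < r.
  have := @cvg_geometric R c l; rewrite gtr0_norm// => /(_ l1).
  move=> /cvgr_lt /(_ r r0) [N _ /(_ N (leqnn N))] /=.
  by exists N.
case: (ex_minnP ex) => -[|n] h mini.
  by move: h; rewrite expr0 mulr1; lra.
exists n; rewrite h /= leNgt; apply/negP => /mini.
by rewrite ltnn.
Qed.

Lemma cvg_lnV (R : realType) (g D : R) :
  (g + D / ln r)%:E @[r --> 0^'+] --> g%:E.
Proof.
have : g + D * (ln r)^-1 @[r --> 0^'+] --> g + D * 0.
  apply: cvgD; first exact: cvg_cst.
  apply: cvgMr; apply/ltr0_cvgV0; last exact: lnNy.
  near=> r; rewrite ln_lt0//; apply/andP; split; near: r.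
    exact: nbhs_right_gt.
  exact: nbhs_right_lt.
rewrite mulr0 addr0 => h; apply: cvg_EFin => //; first by near=> r.
Unshelve. all: by end_near.
Qed.

(** For [delta * l ^+ n.+1 < r <= delta * l ^+ n], the ball lies in a cylinder of length [n] and
    contains one of length [n + k.+1], with [k] independent of [r]. All errors in the logarithm of
    the mass are thus bounded by a constant [D], which vanishes after division by [ln r]. *)
Lemma local_dim_of_bounded (R : realType) (l p delta g C : R)
    (nu : probability R R) (a : nat -> bool) :
  0 < l < 1 -> 0 < p < 1 -> bernoulli_convolution l p nu -> 0 < delta ->
  gapped l delta a ->
  (forall n, `|log_mass p a n - n%:R * (g * ln l)| <= C) ->
  has_local_dim nu (expansion l a) g.
Proof.
move=> /[dup] hl /andP[l0 l1] hp hnu d0 ga hC.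
have lnl : ln l < 0 by rewrite ln_lt0.
have C0 : 0 <= C := le_trans (normr_ge0 _) (hC 0%N).
pose K := l / (1 - l).
have K0 : 0 < K by rewrite divr_gt0//; lra.
have [k hk] : exists k, K * l ^+ k < delta.
  have := @cvg_geometric R K l; rewrite gtr0_norm// => /(_ l1).
  move=> /cvgr_lt /(_ delta d0) [N _ /(_ N (leqnn N))] /=.
  by exists N.
pose D := `|g| * (`|ln delta| - ln l *+ k.+1) + C.
have D0 : 0 <= D.
  rewrite addr_ge0// mulr_ge0// subr_ge0 (@le_trans _ _ 0)// mulrn_wle0//.
  exact: ltW.
have bound r : 0 < r -> r <= delta -> r < 1 ->
    ((g + D / ln r)%:E <= dim_ratio nu (expansion l a) r
      <= (g - D / ln r)%:E)%E.
  move=> r0 rd r1.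
  have lr : ln r < 0 by rewrite ln_lt0 // r0.
  have [n /andP[n1 n2]] := exists_scale hl (introT andP (conj r0 rd)).
  have lnr2 : ln r <= ln delta + n%:R * ln l.
    rewrite mulr_natl -lnXn// -lnM ?posrE ?exprn_gt0//.
    by rewrite ler_ln// posrE ?mulr_gt0 ?exprn_gt0.
  have lnr1 : ln delta + n%:R * ln l + ln l < ln r.
    rewrite -addrA -[X in _ + X](_ : n.+1%:R * ln l = _); last first.
      by rewrite -addn1 natrD mulrDl mul1r.
    rewrite mulr_natl -lnXn// -lnM ?posrE ?exprn_gt0//.
    by rewrite ltr_ln// posrE ?mulr_gt0 ?exprn_gt0.
  have kl : ln l *+ k.+1 <= 0 by rewrite mulrn_wle0// ltW.
  (* Used with [e = 0] for the cylinder of length [n] and with [e = ln l *+ k.+1] for the longer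
     one. *)
  have near_lnr (e : R) : ln l *+ k.+1 <= e <= 0 ->
      `|g * (n%:R * ln l + e) - g * ln r| <= `|g| * (`|ln delta| - ln l *+ k.+1).
    move=> he; rewrite -mulrBr normrM ler_wpM2l//.
    have kl1 : ln l *+ k.+1 <= ln l by rewrite mulrS gerDl mulrn_wle0// ltW.
    have := ler_norm (ln delta); have := ler_norm (- ln delta).
    rewrite normrN ler_norml; lra.
  apply/andP; split.
    apply: dim_ratio_ge; first lra.
    have nule := nu_ball_le hl hp hnu d0 ga n2.
    refine (le_trans nule _).
    rewrite lee_fin ler_expR mulrDl mulfVK ?lt_eqF//.
    have := hC n; have := near_lnr 0; rewrite kl lexx => /(_ isT).
    rewrite addr0 !ler_norml /D; lra.
  apply: dim_ratio_le; first lra.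
  have rK : l ^+ (n + k.+1) * (l / (1 - l)) < r.
    have -> : l ^+ (n + k.+1) * (l / (1 - l)) = K * l ^+ k * l ^+ n.+1.
      by rewrite /K exprD !exprS; ring.
    by apply: lt_trans n1; rewrite ltr_pM2r// exprn_gt0.
  refine (le_trans _ (nu_ball_ge a hl hp hnu rK)).
  rewrite lee_fin ler_expR mulrBl mulfVK ?lt_eqF//.
  have := hC (n + k.+1)%N; have := near_lnr _ (introT andP (conj (lexx _) kl)).
  rewrite natrD -(mulr_natl (ln l)) !ler_norml /D; nra.
apply: squeeze_cvge.
- near=> r; apply: bound; near: r.
  + exact: nbhs_right_gt.
  + exact: nbhs_right_le.
  + exact: nbhs_right_lt.
- exact: cvg_lnV.
- rewrite -[X in _ --> X]/((g)%:E).
  under eq_fun do rewrite -mulNr.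
  exact: cvg_lnV.
Unshelve. all: by end_near.
Qed.

Lemma frequently_right (R : realType) (Q : R -> Prop) :
  (forall e, 0 < e -> exists2 r, 0 < r < e & Q r) ->
  forall V, (0 : R)^'+ V -> exists2 r, V r & Q r.
Proof.
move=> h V; rewrite /at_right /within /= => -[e /= e0 eV].
have [r /andP[r0 re] Qr] := h e e0; exists r => //.
by apply: eV => //=; rewrite sub0r normrN gtr0_norm.
Qed.

(** At lengths where [log_mass] is high, a ball of radius [K * l ^+ n] has ratio at most [Xlo];
    where it is low, one of radius [delta * l ^+ n] has ratio at least [Xhi]. Both kinds of radii
    tend to 0. *)
Lemma oscillating_local_dim (R : realType) (l p delta hlo hhi : R)
    (nu : probability R R) (a : nat -> bool) :
  0 < l < 1 -> 0 < p < 1 -> bernoulli_convolution l p nu -> 0 < delta ->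
  gapped l delta a -> hlo < hhi ->
  (forall m, exists2 n, (m <= n)%N & log_mass p a n <= n%:R * hlo) ->
  (forall m, exists2 n, (m <= n)%N & n%:R * hhi <= log_mass p a n) ->
  (lower_local_dim nu (expansion l a) < upper_local_dim nu (expansion l a))%E.
Proof.
move=> /[dup] hl /andP[l0 l1] hp hnu d0 ga lohi hlo_ hhi_.
have lnl : ln l < 0 by rewrite ln_lt0.
(* A third of the gap absorbs the constants on each side and still leaves [hlo + e < hhi - e]. *)
pose e := (hhi - hlo) / 3.
have e0 : 0 < e by rewrite divr_gt0//; lra.
have large (c A B : R) : 0 < c -> 0 < A -> exists m, forall n, (m <= n)%N ->
    0 < c * l ^+ n < A /\ B <= n%:R * e.
  move=> c0 A0.
  have := @cvg_geometric R c l; rewrite gtr0_norm// => /(_ l1).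
  move=> /cvgr_lt /(_ A A0) [m1 _ hm1].
  pose m2 := Num.truncn (`|B| / e).
  exists (maxn m1 m2.+1) => n; rewrite geq_max => /andP[mn1 mn2]; split.
    by rewrite mulr_gt0 ?exprn_gt0//=; exact: hm1.
  have : `|B| / e < m2.+1%:R by rewrite truncnS_gt.
  rewrite ltr_pdivrMr// => /ltW h; apply: le_trans (ler_norm B) (le_trans h _).
  by rewrite ler_wpM2r ?ler_nat// ltW.
(* The factor 2 provides the strict inequality required by [nu_ball_ge]. *)
pose K := l / (1 - l) * 2.
have K0 : 0 < K by rewrite mulr_gt0// divr_gt0//; lra.
have lnE c n : 0 < c -> ln (c * l ^+ n) = ln c + n%:R * ln l.
  by move=> c0; rewrite lnM ?posrE ?exprn_gt0// lnXn// mulr_natl.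
(* Dividing by [ln l < 0] exchanges the high and the low rates. *)
pose Xlo := (hhi - e) / ln l; pose Xhi := (hlo + e) / ln l.
have Xlohi : Xlo < Xhi by rewrite ltr_nM2r ?invr_lt0// /e; lra.
apply: (@le_lt_trans _ _ Xlo%:E).
  rewrite /lower_local_dim /limf_einf leeNl.
  apply: le_ereal_inf_tmp => _ [V V0 <-].
  have freq s : 0 < s -> exists2 r, 0 < r < s &
      (dim_ratio nu (expansion l a) r <= Xlo%:E)%E.
    move=> s0.
    have [m hm] := large K (Num.min s 1) (Xlo * ln K) K0
      ltac:(by rewrite lt_min s0 ltr01).
    have [n mn Sn] := hhi_ m; have [/andP[r0 r1] hB] := hm n mn.
    move: r1; rewrite lt_min => /andP[rs r1].
    exists (K * l ^+ n); first by rewrite r0.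
    apply: dim_ratio_le; first by rewrite r0.
    refine (le_trans _ (nu_ball_ge (n := n) a hl hp hnu _)).
      rewrite lee_fin ler_expR lnE// mulrDr mulrCA divfK ?lt_eqF//.
      by lra.
    have : 0 < l ^+ n * (l / (1 - l)).
      by rewrite mulr_gt0 ?exprn_gt0 ?divr_gt0//; lra.
    by rewrite /K; move: (l / (1 - l)) => k; lra.
  have [r Vr hr] := frequently_right freq V0.
  apply: le_ereal_sup_tmp; exists (- dim_ratio nu (expansion l a) r)%E.
    by exists r.
  by rewrite leeN2.
apply: (@lt_le_trans _ _ Xhi%:E); first by rewrite lte_fin.
apply: le_ereal_inf_tmp => _ [V V0 <-].
have freq s : 0 < s -> exists2 r, 0 < r < s &
    (Xhi%:E <= dim_ratio nu (expansion l a) r)%E.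
  move=> s0.
  have [m hm] := large delta (Num.min s 1) (- (Xhi * ln delta)) d0
    ltac:(by rewrite lt_min s0 ltr01).
  have [n mn Sn] := hlo_ m; have [/andP[r0 r1] hB] := hm n mn.
  move: r1; rewrite lt_min => /andP[rs r1].
  exists (delta * l ^+ n); first by rewrite r0.
  apply: dim_ratio_ge; first by rewrite r0.
  refine (le_trans (nu_ball_le (n := n) hl hp hnu d0 ga (lexx _)) _).
  rewrite lee_fin ler_expR lnE// mulrDr mulrCA divfK ?lt_eqF//.
  by lra.
have [r Vr hr] := frequently_right freq V0.
by apply: le_ereal_sup_tmp; exists (dim_ratio nu (expansion l a) r) => //; exists r.
Qed.

(** * Balanced digits above the inverse of beta1 *)

Lemma sum_even_powers (R : realType) (l : R) (N : nat) : 0 < l < 1 ->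
  \sum_(1 <= n < N.+1) l ^+ (2 * n) = l ^+ 2 / (1 - l ^+ 2) * (1 - (l ^+ 2) ^+ N).
Proof.
move=> /andP[l0 l1]; have l2 : 1 - l ^+ 2 != 0 by rewrite gt_eqF//; nra.
elim: N => [|N IH]; first by rewrite big_geq// expr0 subrr mulr0.
rewrite big_nat_recr//= IH exprM; move: (l ^+ 2) l2 => y l2.
rewrite exprS; move: (_ ^+ N) => x.
by field; exact: l2.
Qed.

Lemma beta1_lt_ge1 (R : realType) (b l : R) : is_beta1 b -> b^-1 < l < 1 ->
  1 <= l + l ^+ 2 / (1 - l ^+ 2).
Proof.
move=> [b0 hb] /andP[bl l1].
have bV0 : 0 < b^-1 by rewrite invr_gt0.
have l0 : 0 < l by lra.
apply: (@le_trans _ _ (limn (fun N => b^-1 + \sum_(1 <= n < N.+1) (b ^+ (2 * n))^-1))).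
  by rewrite (cvg_lim _ hb).
apply: limr_le; first by apply/cvg_ex; exists 1.
apply: nearW => N; apply: lerD; first exact: ltW.
apply: (@le_trans _ _ (\sum_(1 <= n < N.+1) l ^+ (2 * n))).
  by apply: ler_sum => n _; rewrite -exprVn lerXn2r// ?nnegrE ltW.
have l2 : 0 < 1 - l ^+ 2 by nra.
have hl : 0 < l < 1 by rewrite l0.
rewrite sum_even_powers// ler_piMr//.
  by rewrite divr_ge0// ?exprn_ge0// ltW.
by rewrite gerBl exprn_ge0// exprn_ge0// ltW.
Qed.

(** Comparing the series term by term only gives a weak inequality; the strict one comes from the
    first term, which leaves a margin [b^-1 - l]. *)
Lemma lt_beta1_lt1 (R : realType) (b l : R) : is_beta1 b -> 0 < l < b^-1 ->
  l < 1 /\ l + l ^+ 2 / (1 - l ^+ 2) < 1.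
Proof.
move=> [b0 hb] /andP[l0 lb].
have bV0 : 0 < b^-1 by rewrite invr_gt0.
pose u N := b^-1 + \sum_(1 <= n < N.+1) (b ^+ (2 * n))^-1.
have u1 N : u N <= 1.
  have <- : limn u = 1 by exact: cvg_lim.
  apply: nondecreasing_cvgn_le; last by apply/cvg_ex; exists 1.
  apply/nondecreasing_seqP => n; rewrite /u lerD2l [leRHS]big_nat_recr//=.
  by rewrite lerDl invr_ge0 exprn_ge0// ltW.
have bV1 : b^-1 <= 1 by have := u1 0%N; rewrite /u big_geq// addr0.
have l1 : l < 1 by lra.
split=> //.
have l2 : 0 < 1 - l ^+ 2 by nra.
suff : l + l ^+ 2 / (1 - l ^+ 2) <= 1 - (b^-1 - l) by lra.
have cl : l + l ^+ 2 / (1 - l ^+ 2) * (1 - (l ^+ 2) ^+ N) @[N --> \oo] -->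
    l + l ^+ 2 / (1 - l ^+ 2) * (1 - 0).
  apply: cvgD; first exact: cvg_cst.
  apply: cvgMr; apply: cvgB; first exact: cvg_cst.
  by apply: cvg_expr; rewrite ger0_norm ?exprn_ge0 ?(ltW l0)//; lra.
rewrite subr0 mulr1 in cl.
rewrite -(cvg_lim _ cl)//; apply: limr_le; first by apply/cvg_ex; eexists; exact: cl.
apply: nearW => N; have hl : 0 < l < 1 by rewrite l0.
rewrite -sum_even_powers//.
have := u1 N; rewrite /u.
suff : \sum_(1 <= n < N.+1) l ^+ (2 * n) <=
       \sum_(1 <= n < N.+1) (b ^+ (2 * n))^-1 by lra.
by apply: ler_sum => n _; rewrite -exprVn lerXn2r// ?nnegrE ltW.
Qed.

Lemma lt_golden (R : realType) (l : R) : 0 < l < golden R -> l + l ^+ 2 < 1.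
Proof.
move=> /andP[l0]; rewrite /golden.
have := sqr_sqrtr (ler0n R 5); have := sqrtr_ge0 (5 : R).
move: (Num.sqrt _) => s s0 s5 hl; nra.
Qed.

Definition discrepancy (R : realType) (a : nat -> bool) (n : nat) : R :=
  \sum_(i < n) (if a i then 1 else -1).

Lemma discrepancyS (R : realType) (a : nat -> bool) (n : nat) :
  discrepancy R a n.+1 = discrepancy R a n + (if a n then 1 else -1).
Proof. by rewrite /discrepancy big_ord_recr. Qed.

(** After a digit 0 the tail has value below 1, whereas 11(01)^oo has value [l + v01], at least 1;
    so if that tail starts with 11, what follows is below (01)^oo. Since [v01 < l], the next digit
    is then 0, and the comparison survives each further 01, so no second 11 can occur before a 00.
    The mirror image holds after a digit 1. The change of digit at [m] starts this invariant. *)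
Lemma discrepancy_bounded (R : realType) (l delta : R) (a : nat -> bool) m :
  0 < l < 1 -> l + l ^+ 2 < 1 -> 1 <= l + l ^+ 2 / (1 - l ^+ 2) ->
  0 < delta -> gapped l delta a -> a m != a m.+1 ->
  exists C, forall n, `|discrepancy R a n| <= C.
Proof.
move=> /[dup] hl /andP[l0 l1] lg lb d0 ga am.
pose t n := expansion l (tailn n a).
pose K := l / (1 - l); pose v10 := l / (1 - l ^+ 2).
(* [v10] and [v01] are the values of (10)^oo and (01)^oo. *)
pose v01 := l ^+ 2 / (1 - l ^+ 2).
have l2 : 0 < 1 - l ^+ 2 by nra.
have v01E : v01 = l * v10 by rewrite /v01 /v10; field; rewrite gt_eqF.
have v10E : v10 = l * (1 + v01) by rewrite /v01 /v10; field; rewrite gt_eqF.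
have KE : K = v10 + v01.
  by rewrite /K /v10 /v01; field; apply/andP; split; rewrite gt_eqF//; lra.
have KE' : K = l * (1 + K) by rewrite /K; field; rewrite gt_eqF//; lra.
have v01l : v01 < l by rewrite /v01 ltr_pdivrMr//; nra.
have {}lb : 1 <= l + v01 := lb.
have t0 n : 0 <= t n := expansion_ge0 _ hl.
have tK n : t n <= K := expansion_le _ hl.
have tE n : t n = l * ((a n)%:R + t n.+1) := expansion_tailn a n hl.
have cancel (x y : R) : l * x <= l * y -> x <= y by rewrite ler_pM2l.
have out0 n : a n = false -> t n.+1 < 1.
  move=> an; have := ga n; rewrite -/(t n) tE an add0r => h.
  by rewrite -(ltr_pM2l l0) mulr1; lra.
have out1 n : a n = true -> K - 1 < t n.+1.
  move=> an; have := ga n; rewrite -/(t n) tE an => h.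
  rewrite -(ltr_pM2l l0); move: h; rewrite /K.
  have -> : l ^+ 2 / (1 - l) = l * (l / (1 - l)) by rewrite mulrA.
  by rewrite -/K /=; lra.
pose s n := discrepancy R a n.+1.
have sS n : s n.+1 = s n + (if a n.+1 then 1 else -1) by rewrite /s discrepancyS.
(* [H] is the value of [s] just after each 11, and [H - 2] just after each 00. In
   both cases of the invariant, the first disjunct says that the last double digit
   was 11 and that [t] compares with (01)^oo or (10)^oo accordingly; the second one
   is its mirror image. *)
pose inv n H := if a n
  then (t n.+1 <= v01 /\ s n = H) \/
       [/\ v01 <= t n.+1, l * (1 + t n.+1) <= 1 & s n = H - 1]
  else [/\ t n.+1 <= v10, l * (1 + (K - t n.+1)) <= 1 & s n = H - 1] \/
       (v10 <= t n.+1 /\ s n = H - 2).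
have invS n H : inv n H -> inv n.+1 H.
  rewrite /inv sS; have := tE n.+1; have := t0 n.+2; have := tK n.+2.
  move: (out0 n) (out1 n); move: (t n.+1) (t n.+2) (s n) => x y z o0 o1.
  (* The digits [n] and [n.+1] are in turn 11, 10, 01 and 00. A 11 contradicts the first disjunct
     because [v01 < l], and a 00 contradicts the mirror one. *)
  case: (a n) o0 o1 => o0 o1; case: (a n.+1) => yK y0 /= xE.
  - case=> [[h1 h2]|[h1 h2 h3]]; left.
      by exfalso; nra.
    split; last lra.
    by apply/cancel/cancel; nra.
  - have {}o1 := o1 erefl; case=> [[h1 h2]|[h1 h2 h3]].
      left; split; [by apply: cancel; nra|nra|lra].
    right; split; last lra.
    by apply: cancel; nra.
  - case=> [[h1 h2 h3]|[h1 h2]].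
      left; split; last lra.
      by apply: cancel; nra.
    have {}o0 := o0 erefl.
    right; split; [by apply: cancel; nra|nra|lra].
  - case=> [[h1 h2 h3]|[h1 h2]].
      right; split; last lra.
      suff : K - y <= v01 by lra.
      by apply/cancel/cancel; nra.
    by exfalso; nra.
(* [H] is read off [s m.+1], according to the side of (10)^oo or (01)^oo on which the next tail
   lies. *)
have [H inv0] : exists H, inv m.+1 H.
  rewrite /inv; have := tE m.+1; move: (out0 m) (out1 m).
  move: am; case: (a m); case: (a m.+1) => //= _ o0 o1 h.
    have {}o1 := o1 erefl; case: (leP v10 (t m.+2)) => hv.
      by exists (s m.+1 + 2); right; split; lra.
    by exists (s m.+1 + 1); left; split; [lra|nra|lra].
  have {}o0 := o0 erefl; case: (leP (t m.+2) v01) => hv.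
    by exists (s m.+1); left; split; lra.
  by exists (s m.+1 + 1); right; split; [lra|move: h => /=; lra|lra].
have invn n : inv (m.+1 + n)%N H.
  by elim: n => [|n IH]; rewrite ?addn0// addnS; exact: invS.
exists (`|H| + 2 + m.+2%:R) => n.
have [nm|mn] := leqP n m.+1.
  apply: (@le_trans _ _ n%:R).
    rewrite /discrepancy; apply: (le_trans (ler_norm_sum _ _ _)).
    rewrite (le_trans (ler_sum _ (G := fun=> 1) _))//.
      by move=> i _; case: (a i); rewrite ?normrN1 ?normr1.
    by rewrite sumr_const card_ord.
  have : n%:R <= m.+2%:R :> R by rewrite ler_nat leqW.
  by have := normr_ge0 H; lra.
have := invn (n - m.+2)%N; rewrite /inv.
have <- : n = (m.+1 + (n - m.+2)).+1 by rewrite -addSn subnKC.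
have -> : s (m.+1 + (n - m.+2))%N = discrepancy R a n.
  by rewrite /s -addSn subnKC.
have := ler_norm H; have := ler_norm (- H); rewrite normrN.
have : 0 <= m.+2%:R :> R by [].
rewrite ler_norml; case: (a _) => ? ? ? [[*]|[*]]; apply/andP; split; lra.
Qed.

(** * Hausdorff dimension of Cantor sets *)

(** The digits are read along the orbit of the doubling map [T]; each step halves the error. *)
Lemma binary_expansion (R : realType) (x : R) : 0 <= x <= 1 ->
  exists f, x = expansion (1 / 2) f.
Proof.
move=> hx.
have h2 : 0 < (1 / 2 : R) < 1 by lra.
pose T (y : R) := if y < 1 / 2 then 2 * y else 2 * y - 1.
pose f y : nat -> bool := fun n => ~~ (iter n T y < 1 / 2).
have TI y : 0 <= y <= 1 -> 0 <= T y <= 1.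
  by rewrite /T => hy; case: ltP => h; lra.
have fS y : tailn 1 (f y) = f (T y).
  by apply/funext => n; rewrite /tailn /f add1n iterSr.
exists (f x).
have approx n y : 0 <= y <= 1 -> `|y - expansion (1 / 2) (f y)| <= (1 / 2) ^+ n.
  elim: n y => [|n IH] y hy.
    have := expansion_ge0 (f y) h2; have := expansion_le (f y) h2.
    have -> : 1 / 2 / (1 - 1 / 2) = 1 :> R by field.
    by rewrite expr0 ler_norml; lra.
  have := IH _ (TI _ hy); rewrite (expansionE (f y))// fS exprS.
  move: (expansion _ _) => e; rewrite /f /= /T; case: ltP => /= h;
    rewrite !ler_norml; move: (_ ^+ n) => z; lra.
have lim0 : (1 / 2 : R) ^+ n @[n --> \oo] --> (0 : R).
  by apply: cvg_expr; rewrite ger0_norm; lra.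
apply/eqP; rewrite -subr_eq0 -normr_le0 -(cvg_lim _ lim0)//.
apply: limr_ge; first by apply/cvg_ex; exists 0.
by apply: nearW => n; exact: approx.
Qed.

Lemma norm_le_diam (R : realType) (U : set R) (x y : R) : U x -> U y ->
  (`|x - y|%:E <= diam U)%E.
Proof. by move=> Ux Uy; apply: ereal_sup_ubound; exists (x, y). Qed.

Lemma diam_pow_fin (R : realType) (s : R) (U : set R) :
  (diam U <= 1%:E)%E ->
  exists2 u, diam_pow s U = u%:E /\ 0 <= u &
    forall x y, 0 <= s -> U x -> U y -> `|x - y| `^ s <= u.
Proof.
move=> U1; rewrite /diam_pow; case: eqP => [U0|/eqP/set0P[z Uz]].
  by exists 0 => // x y _; rewrite U0.
have := norm_le_diam Uz Uz; rewrite subrr normr0 => d0.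
have [m dm] : exists m, diam U = m%:E.
  case: (diam U) U1 d0 => [m _ _|//|//]; first by exists m.
exists (m `^ s); first by rewrite dm poweR_EFin powR_ge0.
move=> x y s0 Ux Uy; have := norm_le_diam Ux Uy; rewrite dm lee_fin => h.
by apply: ge0_ler_powR; rewrite ?nnegrE//; apply: le_trans h.
Qed.

(** If the measure were 0, some cover of [A] would have a sum of powers of diameters below [c / 4],
    and [0, 1] would be covered by intervals of total length at most [(2 / c) * (c / 4) = 1 / 2]. *)
Lemma hausdorff_measure_Cantor_neq0 (R : realType) (A : set R) (c kappa s : R)
    (phi : (nat -> bool) -> R) :
  0 < c <= 1 -> 0 < kappa < 1 -> 0 <= s <= 1 -> s * - ln kappa <= ln 2 ->
  (forall f, A (phi f)) ->
  (forall f f' q, f q != f' q -> c * kappa ^+ q <= `|phi f - phi f'|) ->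
  hausdorff_measure s A != 0%E.
Proof.
move=> /andP[c0 c1] /andP[k0 k1] /andP[s0 s1] sk Aphi sep; apply/eqP => HA0.
have h2 : 0 < (1 / 2 : R) < 1 by lra.
have pre0 : (hausdorff_premeasure s 1 A <= 0)%E.
  by rewrite -HA0; apply: ereal_sup_ubound; exists 1 => /=.
have c4 : 0 < c / 4 by rewrite divr_gt0.
have /ereal_inf_lt[_ [U [AU Ud] <-] sumU] :
    (hausdorff_premeasure s 1 A < (c / 4)%:E)%E.
  by apply: (le_lt_trans pre0); rewrite lte_fin.
(* Reading the bits in base 2 is a Hoelder map from the range of [phi] onto
   [0, 1], so covers of the former give covers of the latter by intervals. *)
have holder f f' : `|expansion (1 / 2) f - expansion (1 / 2) f'|
    <= `|phi f - phi f'| `^ s / c.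
  have [<-|ff'] := pselect (f = f').
    by rewrite subrr normr0 divr_ge0 ?powR_ge0// ltW.
  have ex : exists q, f q != f' q.
    apply: contrapT => h; apply: ff'; apply/funext => q.
    by apply/eqP; apply: contrapT => /negP hq; apply: h; exists q.
  case: (ex_minnP ex) => q fq minq.
  have := @expansion_prefix R (1 / 2) f f' q h2.
  have -> : 1 / 2 / (1 - 1 / 2) = 1 :> R by field.
  rewrite mulr1 => h; apply: le_trans (h _) _.
    move=> i iq; apply/eqP; apply: contraTT iq => /minq.
    by rewrite -leqNgt.
  (* The hypothesis on [s] says that [kappa] to the power [s] is at least 1/2. *)
  apply: (@le_trans _ _ ((kappa ^+ q) `^ s)).
    rewrite -ler_ln ?posrE ?powR_gt0 ?exprn_gt0//.
    rewrite ln_powR lnXn// lnXn// -[leLHS]mulr_natl -[ln kappa *+ q]mulr_natl.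
    rewrite mulrCA ler_wpM2l ?ler0n// mul1r lnV ?posrE//.
    by rewrite lerNl -mulrN.
  have {}h := sep _ _ _ fq.
  apply: (@le_trans _ _ ((`|phi f - phi f'| / c) `^ s)).
    apply: ge0_ler_powR; rewrite ?nnegrE ?exprn_ge0 ?divr_ge0 ?(ltW k0) ?(ltW c0)//.
    by rewrite ler_pdivlMr// mulrC.
  rewrite powRM// ?invr_ge0 ?(ltW c0)//.
  rewrite ler_wpM2l ?powR_ge0// -[leRHS]powRr1 ?invr_ge0 ?(ltW c0)//.
  (* As [c] and [s] are at most 1, the power [s] of [c^-1] is at most [c^-1]. *)
  by apply: ler_powR => //; rewrite invf_ge1.
pose I k (y : R) := `[y - fine (diam_pow s (U k)) / c,
                      y + fine (diam_pow s (U k)) / c]%classic.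
have /choice[y hy] : forall k, exists y, forall f, U k (phi f) ->
    I k y (expansion (1 / 2) f).
  move=> k; have [u [uE u0] hu] := diam_pow_fin s (Ud k).
  have [[f0 Uf0]|no] := pselect (exists f, U k (phi f)); last first.
    by exists 0 => f Uf; exfalso; apply: no; exists f.
  exists (expansion (1 / 2) f0) => f Uf.
  rewrite /I uE /= in_itv/= -ler_distlC distrC.
  apply: le_trans (holder f f0) _.
  by rewrite ler_pM2r ?invr_gt0//; exact: hu.
have cover : `[0, 1]%classic `<=` \bigcup_k I k (y k).
  move=> x /=; rewrite in_itv /= => /binary_expansion[f ->].
  have [k _ Uk] := AU _ (Aphi f).
  by exists k => //; exact: hy.
have h1 : (lebesgue_measure (`[0%R, 1%R]%classic : set R) <=
    \sum_(0 <= k <oo) lebesgue_measure (I k (y k)))%E.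
  by apply: measure_sigma_subadditive => // k; exact: measurable_itv.
rewrite lebesgue_measure_itv /= lte_fin ltr01 oppr0 adde0 in h1.
suff : (1%:E <= (2 / c)%:E * (c / 4)%:E :> \bar R)%E.
  have -> : ((2 / c)%:E * (c / 4)%:E = (1 / 2)%:E :> \bar R)%E.
    by rewrite -EFinM; congr EFin; field; rewrite gt_eqF.
  by rewrite lee_fin; lra.
apply: (le_trans h1).
apply: (@le_trans _ _ ((2 / c)%:E * \sum_(0 <= k <oo) diam_pow s (U k))%E); last first.
  by rewrite lee_pmul2l ?lte_fin ?divr_gt0// ltW.
rewrite -nneseriesZl; last first.
  by move=> k _; have [u [-> u0] _] := diam_pow_fin s (Ud k).
apply: lee_nneseries => // k _.
have [u [uE u0] _] := diam_pow_fin s (Ud k).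
rewrite /I uE /= lebesgue_measure_itv /=.
have uc : 0 <= u / c by rewrite divr_ge0// ltW.
case: ifP => _; last by rewrite -EFinM lee_fin mulr_ge0// divr_ge0// ltW.
rewrite -EFinM lee_fin.
have -> : 2 / c * u = u / c * 2 by ring.
by lra.
Qed.

(** Every exponent below [s0] satisfies the condition of the previous lemma, so the dimension is at
    least [s0]. *)
Lemma hausdorff_dim_Cantor_gt0 (R : realType) (A : set R) (c kappa : R)
    (phi : (nat -> bool) -> R) :
  0 < c -> 0 < kappa < 1 -> (forall f, A (phi f)) ->
  (forall f f' q, f q != f' q -> c * kappa ^+ q <= `|phi f - phi f'|) ->
  (0 < hausdorff_dim A)%E.
Proof.
move=> c0 hk Aphi sep.
have lk : 0 < - ln kappa by rewrite oppr_gt0 ln_lt0.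
pose s0 := Num.min 1 (ln 2 / - ln kappa).
have s00 : 0 < s0 by rewrite lt_min ltr01 divr_gt0// ln_gt0// ltr1n.
apply: (@lt_le_trans _ _ s0%:E); first by rewrite lte_fin.
apply: le_ereal_inf_tmp => _ [s [sge0 Hs] <-]; rewrite lee_fin leNgt.
apply/negP; rewrite lt_min => /andP[s1]; rewrite ltr_pdivlMr// => s2.
move/eqP: Hs; apply/negP.
have [k0 k1] := andP hk.
apply: (@hausdorff_measure_Cantor_neq0 _ _ (Num.min c 1) kappa s phi) => //.
- by rewrite lt_min c0 ltr01 ge_min lexx orbT.
- by rewrite sge0 ltW.
- exact: ltW.
- move=> f f' q fq; apply: le_trans (sep _ _ _ fq).
  by rewrite ler_wpM2r ?exprn_ge0 ?(ltW k0)// ge_min lexx.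
Qed.

(** * Univoque sequences below the inverse of beta1 *)

Definition blocks (B : nat) (w : nat -> nat -> bool) (n : nat) : bool :=
  w (n %/ B)%N (n %% B)%N.

Lemma blocksE (B : nat) (w : nat -> nat -> bool) (q j : nat) :
  (j < B)%N -> blocks B w (q * B + j) = w q j.
Proof.
move=> jB; have B0 : (0 < B)%N by apply: leq_ltn_trans jB.
by rewrite /blocks divnMDl// divn_small// addn0 modnMDl modn_small.
Qed.

Lemma sum_blocks (R : realType) (B : nat) (w : nat -> nat -> bool)
    (F : bool -> R) (Q : nat) :
  \sum_(i < Q * B) F (blocks B w i) = \sum_(q < Q) \sum_(j < B) F (w q j).
Proof.
elim: Q => [|Q IH]; first by rewrite mul0n !big_ord0.
rewrite big_ord_recr/= -IH mulSn addnC big_split_ord/=; congr (_ + _).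
by apply: eq_bigr => j _; rewrite blocksE.
Qed.

(* Concatenation of the words 1^N(10)^k and 0^N(10)^k chosen by [b]. *)
Definition concat_words (N k : nat) (b : nat -> bool) : nat -> bool :=
  blocks (N + k.*2) (fun q j => if (j < N)%N then b q else ~~ odd (j - N)).

(* 1^(N+1) 0 (10)^(k-1) 1^oo *)
Definition top_tail (N k : nat) (i : nat) : bool :=
  [|| (i < N)%N, (N + k.*2 <= i)%N | ~~ odd (i - N)].

(* In a tail that follows a digit 0, only the case 11 has to be compared with [e]:
   0 and 10 lead to values below 1 as soon as l + l^2 < 1. *)
Definition dominated (e c : nat -> bool) : Prop :=
  forall n, ~~ c n ->
    [\/ ~~ c n.+1, c n.+1 /\ ~~ c n.+2 | forall i, c (n.+1 + i)%N -> e i].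

Lemma concat_wordsE (N k : nat) (b : nat -> bool) (q j : nat) :
  (j < N + k.*2)%N ->
  concat_words N k b (q * (N + k.*2) + j) =
  if (j < N)%N then b q else ~~ odd (j - N).
Proof. exact: blocksE. Qed.

Lemma concat_words_start (N k : nat) (b : nat -> bool) (q : nat) :
  (0 < N)%N -> concat_words N k b (q * (N + k.*2)) = b q.
Proof.
by move=> N0; rewrite -[X in concat_words _ _ _ X]addn0 concat_wordsE ?N0//; lia.
Qed.

(** A 0 is followed by 11 only when it ends a word and the next word is 1^N(10)^k; [top_tail]
    continues this word by ones only. *)
Lemma dominated_concat_words (N k : nat) (b : nat -> bool) :
  (0 < N)%N -> (0 < k)%N -> dominated (top_tail N k) (concat_words N k b).
Proof.
move=> N0 k0 n.
set L := (N + k.*2)%N; have L0 : (0 < L)%N by lia.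
rewrite (divn_eq n L); move: (n %/ L)%N (ltn_pmod n L0) => q.
move: (n %% L)%N => j jL; rewrite concat_wordsE//.
have [jN|Nj] := ltnP j N => cn.
  have [j1N|j1N] := ltnP j.+1 N.
    by constructor 1; rewrite -addnS concat_wordsE ?j1N//; lia.
  constructor 2; rewrite -!addnS !concat_wordsE; try lia.
  by do 2 (case: ifP; first lia); split; lia.
have [j1L|j1L] := ltnP j.+1 L.
  constructor 2; rewrite -!addnS !concat_wordsE; try lia.
  by do 2 (case: ifP; first lia); split; lia.
have nE : (q * L + j).+1 = (q.+1 * L)%N by lia.
case bq : (b q.+1); last first.
  by constructor 1; rewrite nE concat_words_start// bq.
constructor 3 => i; rewrite nE /top_tail.
have [iL|Li] := ltnP i L; last by rewrite orbT.
by rewrite concat_wordsE//; case: ltnP.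
Qed.

(** Here the critical case is the last 1 of a word followed by 0^N(10)^k. After flipping, the tail
    starts with 1^(N+1)(01)^k, again below [top_tail] digit by digit. *)
Lemma dominated_flip_concat_words (N k : nat) (b : nat -> bool) :
  (0 < N)%N -> (0 < k)%N -> dominated (top_tail N k) (flip (concat_words N k b)).
Proof.
move=> N0 k0 n; rewrite /flip.
set L := (N + k.*2)%N; have L0 : (0 < L)%N by lia.
rewrite (divn_eq n L); move: (n %/ L)%N (ltn_pmod n L0) => q.
move: (n %% L)%N => j jL; rewrite concat_wordsE//.
have [jN|Nj] := ltnP j N => cn.
  constructor 1; rewrite -addnS concat_wordsE; last lia.
  by case: ifP => // j1N; lia.
have j1L : (j.+1 < L)%N by lia.
have [j2L|j2L] := ltnP j.+2 L.
  constructor 2; rewrite -!addnS !concat_wordsE; try lia.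
  by do 2 (case: ifP; first lia); split; lia.
have nE : (q * L + j).+2 = (q.+1 * L)%N by lia.
case bq : (b q.+1).
  constructor 2; rewrite nE concat_words_start// bq -addnS concat_wordsE; try lia.
  by case: ifP; first lia; split; lia.
constructor 3 => -[|i]; first by rewrite /top_tail N0.
rewrite addnS -addSn nE /top_tail.
have [iL|Li] := ltnP i.+1 L; last by rewrite orbT.
by rewrite concat_wordsE; last lia; case: ifP; lia.
Qed.

(** The three terms of [M0] bound the three cases of [dominated]. In the case 10, the map sending
    [x] to [l + l ^+ 2 * x] has fixed point [l / (1 - l ^+ 2)] and contracts, so iterating it makes
    the error term of [approx] vanish. *)
Lemma dominated_tail_le (R : realType) (l : R) (e : nat -> bool) :
  0 < l < 1 -> l + l ^+ 2 < 1 -> expansion l e < 1 ->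
  exists2 M, M < 1 & forall c, dominated e c ->
    forall n, ~~ c n -> expansion l (tailn n.+1 c) <= M.
Proof.
move=> /[dup] hl /andP[l0 l1] l2 e1.
pose K := l / (1 - l).
have KE : K = l * (1 + K) by rewrite /K; field; rewrite gt_eqF//; lra.
have K0 : 0 < K by rewrite divr_gt0//; lra.
pose M0 := Num.max (expansion l e) (Num.max (l * K) (l / (1 - l ^+ 2))).
have l21 : 0 < 1 - l ^+ 2 by nra.
have M01 : M0 < 1.
  rewrite /M0 !gt_max e1 ltr_pdivrMr//=; apply/andP; split; last lra.
  by rewrite /K mulrA ltr_pdivrMr; lra.
have M0e : expansion l e <= M0 by rewrite /M0 le_max lexx.
have M0K : l * K <= M0 by rewrite /M0 !le_max lexx orbT.
have M0l : l / (1 - l ^+ 2) <= M0 by rewrite /M0 !le_max lexx !orbT.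
have {}M0l : l + l ^+ 2 * M0 <= M0 by move: M0l; rewrite ler_pdivrMr//; lra.
exists M0 => // c hc n.
have approx i m : ~~ c m ->
    expansion l (tailn m.+1 c) <= M0 + K * (l ^+ 2) ^+ i.
  elim: i m => [|i IH] m cm.
    rewrite expr0 mulr1; have := expansion_le (tailn m.+1 c) hl; rewrite -/K.
    have : 0 <= l * K by rewrite mulr_ge0// ltW.
    lra.
  have pos : 0 <= K * (l ^+ 2) ^+ i.+1.
    by rewrite mulr_ge0 ?exprn_ge0// ltW.
  have [c1|[c1 c2]|ce] := hc m cm.
  - have := expansion_le (tailn m.+2 c) hl; rewrite -/K.
    rewrite (expansion_tailn c m.+1)// (negPf c1) add0r -(ler_pM2l l0); lra.
  - have := IH _ c2; rewrite (expansion_tailn c m.+1)// c1.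
    rewrite (expansion_tailn c m.+2)// (negPf c2) add0r exprS.
    move: pos; rewrite exprS; move: (_ ^+ i) => z pos.
    have : 0 <= l ^+ 2 by rewrite exprn_ge0// ltW.
    move: (expansion _ _) => x l20 /(ler_wpM2l l20); rewrite /=; lra.
  - apply: (@le_trans _ _ (expansion l e)); last lra.
    by apply: le_expansion => // i'; exact: ce.
move=> cn.
have lim0 : M0 + K * (l ^+ 2) ^+ i @[i --> \oo] --> M0 + K * 0.
  apply: cvgD; first exact: cvg_cst.
  apply: cvgMr; apply: cvg_expr; rewrite ger0_norm ?exprn_ge0 ?(ltW l0)//; lra.
rewrite mulr0 addr0 in lim0; rewrite -(cvg_lim _ lim0)//.
apply: limr_ge; first by apply/cvg_ex; exists M0.
by apply: nearW => i; exact: approx.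
Qed.

Lemma gapped_concat_words (R : realType) (l : R) (N k : nat) :
  0 < l < 1 -> l + l ^+ 2 < 1 -> (0 < N)%N -> (0 < k)%N ->
  expansion l (top_tail N k) < 1 ->
  exists2 delta, 0 < delta & forall b, gapped l delta (concat_words N k b).
Proof.
move=> /[dup] hl /andP[l0 l1] l2 N0 k0 adm.
have [M M1 hM] := dominated_tail_le hl l2 adm.
(* A digit 0 gives a value at most [l * M = l - l * (1 - M)], uniformly in [b]; digit 1 follows by
   flipping. *)
exists (l * (1 - M)) => [|b n]; first by rewrite mulr_gt0//; lra.
rewrite (expansion_tailn _ n)//; case: ifPn => cn.
  have := hM _ (dominated_flip_concat_words (b := b) N0 k0) n.
  rewrite {1}/flip cn => /(_ isT).
  have -> : tailn n.+1 (flip (concat_words N k b)) =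
    flip (tailn n.+1 (concat_words N k b)) by [].
  rewrite expansion_flip// -(ler_pM2l l0) mulrBr mulrA -expr2 /=.
  by move: (l ^+ 2 / _) (expansion _ _) => x y; lra.
have := hM _ (dominated_concat_words (b := b) N0 k0) n cn.
by rewrite -(ler_pM2l l0) (negPf cn) /=; lra.
Qed.

(* The pair [f q], [~~ f q] carries one free bit without changing the digit counts,
   and the [M] copies of [d q] are used to tune the frequency. *)
Definition interleave (M : nat) (d f : nat -> bool) : nat -> bool :=
  blocks M.+2 (fun q j => if j is j'.+1 then if j' is _.+1 then d q else ~~ f q
                          else f q).

Definition cantor_digits (N k M : nat) (d f : nat -> bool) : nat -> bool :=
  concat_words N k (interleave M d f).

Lemma cantor_digits_start (N k M : nat) (d f : nat -> bool) (q : nat) :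
  (0 < N)%N -> cantor_digits N k M d f (q * (M.+2 * (N + k.*2))) = f q.
Proof.
move=> N0; rewrite mulnA /cantor_digits concat_words_start//.
by rewrite -[X in interleave _ _ _ X]addn0 /interleave blocksE.
Qed.

(** The bit [f q] is the digit at position [q * B], so by [gapped_digits] changing it moves the
    value by at least [delta * (l ^+ B) ^+ q]. *)
Lemma cantor_family_dim (R : realType) (l delta : R) (A : set R)
    (N k M : nat) (d : nat -> bool) :
  0 < l < 1 -> 0 < delta -> (0 < N)%N ->
  (forall b, gapped l delta (concat_words N k b)) ->
  (forall f, A (expansion l (cantor_digits N k M d f))) ->
  (0 < hausdorff_dim A)%E.
Proof.
move=> /[dup] hl /andP[l0 l1] d0 N0 gap hA.
pose B := (M.+2 * (N + k.*2))%N.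
have B0 : (0 < B)%N by rewrite /B muln_gt0/=; lia.
apply: (@hausdorff_dim_Cantor_gt0 R A delta (l ^+ B)
  (fun f => expansion l (cantor_digits N k M d f))) => //.
  by rewrite exprn_gt0//= exprn_ilt1// -?lt0n// ltW.
move=> f f' q fq; rewrite leNgt; apply: contra fq => h; apply/eqP.
rewrite -[LHS](@cantor_digits_start N k M d) // -[RHS](@cantor_digits_start N k M d)//.
apply: (gapped_digits hl d0 (gap _) _ (leqnn _)).
by rewrite mulnC exprM.
Qed.

(** In each group of [M.+2] words, the parts (10)^k and the pair [f q], [~~ f q] contribute equally
    many zeros and ones; only the [N * M] digits equal to [d q] are unbalanced. Hence [f]
    disappears. *)
Lemma log_mass_cantor_digits (R : realType) (p : R) (N k M : nat)
    (d f : nat -> bool) (Q : nat) :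
  log_mass p (cantor_digits N k M d f) (Q * (M.+2 * (N + k.*2))) =
  Q%:R * ((M.+2 * k + N)%:R * (ln p + ln (1 - p)))
  + (N * M)%:R * \sum_(q < Q) ln (digit_weight p (d q)).
Proof.
pose F b := ln (digit_weight p b).
have words b n : log_mass p (concat_words N k b) (n * (N + k.*2)) =
    \sum_(q < n) (N%:R * F (b q) + k%:R * (F false + F true)).
  rewrite /log_mass (sum_blocks _ _ F); apply: eq_bigr => q _.
  rewrite big_split_ord/=; congr (_ + _).
    rewrite (eq_bigr (fun=> F (b q))).
      by rewrite sumr_const card_ord mulr_natl.
    by move=> i _; rewrite ltn_ord.
  rewrite (eq_bigr (fun i : 'I_k.*2 => F (~~ odd i))); last first.
    by move=> i _; rewrite ltnNge leq_addr/= addKn.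
  rewrite -(big_mkord xpredT (fun i => F (~~ odd i))).
  elim: k => [|m IH]; first by rewrite big_geq// mul0r.
  rewrite doubleS !big_nat_recr//= IH odd_double /= mulrSr mulrDl mul1r.
  by rewrite -addrA [F true + _]addrC.
rewrite /cantor_digits mulnA words (sum_blocks _ _
  (fun b => N%:R * F b + k%:R * (F false + F true))).
rewrite (eq_bigr (fun q : 'I_Q => (M.+2 * k + N)%:R * (ln p + ln (1 - p)) +
  (N * M)%:R * F (d q))).
  rewrite big_split/= sumr_const card_ord mulr_sumr; congr (_ + _).
  by rewrite [RHS]mulr_natl.
move=> q _; rewrite !big_ord_recl/=.
rewrite (eq_bigr (fun=> N%:R * F (d q) + k%:R * (F false + F true))).
  rewrite sumr_const card_ord -mulr_natl natrD !natrM -addn2 natrD /F.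
  by case: (f q); rewrite /=; ring.
by [].
Qed.

(** * Tuning the digit frequencies *)

Lemma digit_weight_sum (R : realType) (p : R) (d : nat -> bool) (Q : nat) :
  \sum_(q < Q) ln (digit_weight p (d q)) =
  Q%:R * ln p + (\sum_(q < Q) (d q)%:R) * (ln (1 - p) - ln p).
Proof.
elim: Q => [|Q IH]; first by rewrite !big_ord0 !mul0r addr0.
by rewrite !big_ord_recr/= IH mulrSr; case: (d Q); rewrite /=; ring.
Qed.

Lemma log_mass_dist (R : realType) (p : R) (a : nat -> bool) (m n : nat) :
  `|log_mass p a (m + n) - log_mass p a m| <=
  n%:R * (`|ln p| + `|ln (1 - p)|).
Proof.
rewrite /log_mass big_split_ord/= addrAC subrr add0r.
apply: le_trans (ler_norm_sum _ _ _) _.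
apply: (@le_trans _ _ (\sum_(i < n) (`|ln p| + `|ln (1 - p)|))).
  apply: ler_sum => i _; rewrite /digit_weight.
  by case: ifP => _; rewrite ?lerDl ?lerDr.
by rewrite sumr_const card_ord mulr_natl.
Qed.

(** A Sturmian construction: [d] marks the increments of the integer part of [n%:R * alpha], so its
    partial sums are these integer parts. *)
Lemma exists_frequency (R : realType) (alpha : R) : 0 <= alpha <= 1 ->
  exists d : nat -> bool,
    forall Q, `|\sum_(q < Q) (d q)%:R - Q%:R * alpha| <= 1.
Proof.
move=> /andP[a0 a1].
pose t n := Num.truncn (n%:R * alpha).
have t_itv n : (t n)%:R <= n%:R * alpha < (t n).+1%:R.
  by apply: truncn_itv; rewrite mulr_ge0.
have tS n : (t n <= t n.+1 <= (t n).+1)%N.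
  have /andP[h1 h2] := t_itv n; have /andP[h3 h4] := t_itv n.+1.
  move: h3 h4; rewrite [n.+1%:R]mulrSr mulrDl mul1r => h3 h4.
  have c1 : (t n)%:R < (t n.+1).+1%:R :> R by lra.
  have c2 : (t n.+1)%:R < (t n).+2%:R :> R.
    by rewrite [(t n).+2%:R]mulrSr; lra.
  by move: c1 c2; rewrite !ltr_nat; lia.
exists (fun n => t n.+1 != t n) => Q.
have -> : \sum_(q < Q) (t q.+1 != t q)%:R = (t Q)%:R :> R.
  elim: Q => [|Q IH]; first by rewrite big_ord0 /t mul0r truncn0.
  rewrite big_ord_recr/= IH -natrD; congr (_%:R).
  have := tS Q; case: eqP => /=; lia.
have := t_itv Q; rewrite mulrSr ler_norml => /andP[h1 h2].
by apply/andP; split; lra.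
Qed.

Lemma local_dim_cantor_digits (R : realType) (l p delta g : R)
    (nu : probability R R) (N k M : nat) :
  0 < l < 1 -> 0 < p < 1 / 2 -> bernoulli_convolution l p nu -> 0 < delta ->
  (0 < N)%N -> (0 < M)%N ->
  (forall b, gapped l delta (concat_words N k b)) ->
  let rho := (M.+2 * k + N)%:R / (M.+2 * (N + k.*2))%:R in
  (rho * ln p + (1 - rho) * ln (1 - p)) / ln l <= g <=
    ((1 - rho) * ln p + rho * ln (1 - p)) / ln l ->
  exists d, forall f,
    has_local_dim nu (expansion l (cantor_digits N k M d f)) g.
Proof.
move=> /[dup] hl /andP[l0 l1] hp hnu d0 N0 M0 gap rho.
have hp1 : 0 < p < 1 by lra.
have lnl : ln l < 0 by rewrite ln_lt0.
have lnp : ln p < ln (1 - p) by rewrite ltr_ln ?posrE; lra.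
rewrite ler_ndivrMr// ler_ndivlMr// => /andP[g1 g2].
pose B := (M.+2 * (N + k.*2))%N.
pose c := (M.+2 * k + N)%N.
have BE : B = (2 * c + N * M)%N by rewrite /B /c; lia.
have B0 : 0 < B%:R :> R by rewrite ltr0n /B muln_gt0/=; lia.
have NM0 : 0 < (N * M)%:R :> R by rewrite ltr0n muln_gt0 N0.
have rhoB : rho * B%:R = c%:R by rewrite /rho divfK// gt_eqF.
have BER : B%:R = 2 * c%:R + (N * M)%:R :> R by rewrite BE natrD natrM.
pose D := ln (1 - p) - ln p.
have D0 : 0 < D by rewrite subr_gt0.
(* The frequency of ones in [d] for which a group of [B] digits contributes [B%:R * (g * ln l)] on
   average. The bounds on [g] amount to [alpha] lying in [0, 1]. *)
pose alpha := (B%:R * (g * ln l) - c%:R * (ln p + ln (1 - p)) - (N * M)%:R * ln p)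
  / ((N * M)%:R * D).
have alphaE : (N * M)%:R * D * alpha =
    B%:R * (g * ln l) - c%:R * (ln p + ln (1 - p)) - (N * M)%:R * ln p.
  by rewrite /alpha mulrC divfK// gt_eqF// mulr_gt0.
have [d hd] : exists d : nat -> bool,
    forall Q, `|\sum_(q < Q) (d q)%:R - Q%:R * alpha| <= 1.
  apply: exists_frequency; apply/andP; split.
    rewrite divr_ge0 ?mulr_ge0 ?(ltW D0) ?(ltW NM0)//.
    have : B%:R * ((1 - rho) * ln p + rho * ln (1 - p)) <= B%:R * (g * ln l).
      by rewrite ler_pM2l.
    have -> : B%:R * ((1 - rho) * ln p + rho * ln (1 - p)) =
      B%:R * ln p + (rho * B%:R) * (ln (1 - p) - ln p) by ring.
    by rewrite rhoB BER; nra.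
  rewrite ler_pdivrMr ?mulr_gt0// mul1r.
  have : B%:R * (g * ln l) <= B%:R * (rho * ln p + (1 - rho) * ln (1 - p)).
    by rewrite ler_pM2l.
  have -> : B%:R * (rho * ln p + (1 - rho) * ln (1 - p)) =
    B%:R * ln (1 - p) + (rho * B%:R) * (ln p - ln (1 - p)) by ring.
  by rewrite rhoB BER /D; nra.
exists d => f.
pose V := `|ln p| + `|ln (1 - p)|.
apply: (@local_dim_of_bounded R l p delta g
  (* The three terms account for the mass of an incomplete group, the error on the frequency of [d],
     and the linear term over the incomplete group. *)
  (B%:R * V + (N * M)%:R * D + B%:R * `|g * ln l|)) => //; first exact: gap.
move=> n; rewrite (divn_eq n B); move: (n %/ B)%N => Q.
have jB : (n %% B < B)%N by rewrite ltn_mod -(ltr0n R).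
move: (n %% B)%N jB => j jB.
set a := cantor_digits _ _ _ _ _.
have h1 := log_mass_dist p a (Q * B) j.
have jBR : j%:R <= B%:R :> R by rewrite ler_nat ltnW.
have V0 : 0 <= V by rewrite addr_ge0.
have {}h1 : `|log_mass p a (Q * B + j) - log_mass p a (Q * B)| <= B%:R * V.
  by apply: (le_trans h1); rewrite ler_wpM2r.
have h2 : log_mass p a (Q * B) - (Q * B)%:R * (g * ln l) =
    (N * M)%:R * D * (\sum_(q < Q) (d q)%:R - Q%:R * alpha).
  rewrite log_mass_cantor_digits digit_weight_sum [RHS]mulrBr.
  have -> : (N * M)%:R * D * (Q%:R * alpha) = Q%:R * ((N * M)%:R * D * alpha).
    by ring.
  by rewrite alphaE [(Q * B)%:R]natrM -/c -/D; ring.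
have h3 : `|log_mass p a (Q * B) - (Q * B)%:R * (g * ln l)| <= (N * M)%:R * D.
  rewrite h2 normrM gtr0_norm ?mulr_gt0// ler_piMr// ltW// mulr_gt0//.
have h4 : `|j%:R * (g * ln l)| <= B%:R * `|g * ln l|.
  by rewrite normrM normr_nat ler_wpM2r.
have -> : log_mass p a (Q * B + j) - (Q * B + j)%:R * (g * ln l) =
    (log_mass p a (Q * B + j) - log_mass p a (Q * B)) +
    (log_mass p a (Q * B) - (Q * B)%:R * (g * ln l)) - j%:R * (g * ln l).
  by rewrite natrD; ring.
apply: (le_trans (ler_normB _ _)); apply: lerD => //.
by apply: (le_trans (ler_normD _ _)); apply: lerD.
Qed.

Lemma exists_oscillating_frequency (R : realType) :
  exists d : nat -> bool,
    (forall m, exists2 Q, (m <= Q)%N & \sum_(q < Q) (d q)%:R <= Q%:R / 3 :> R) /\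
    (forall m, exists2 Q, (m <= Q)%N &
       Q%:R * (2 / 3) <= \sum_(q < Q) (d q)%:R :> R).
Proof.
(* [d] is constant on each [[4^j - 1, 4^(j+1) - 1[], which dominates what precedes. *)
pose d q := odd (trunc_log 4 q.+1).
pose Q j := (4 ^ j).-1.
have p4 j : (0 < 4 ^ j)%N by rewrite expn_gt0.
have QS j : Q j.+1 = (Q j + 3 * 4 ^ j)%N by have := p4 j; rewrite /Q expnS; lia.
have leQ m : (m <= Q m)%N by have := ltn_expl m (isT : (1 < 4)%N); rewrite /Q; lia.
pose S n : R := \sum_(q < n) (d q)%:R.
have SS j : S (Q j.+1) = S (Q j) + (3 * 4 ^ j)%:R * (odd j)%:R.
  rewrite /S QS big_split_ord/=; congr (_ + _).
  rewrite (eq_bigr (fun=> (odd j)%:R)).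
    by rewrite sumr_const card_ord [RHS]mulr_natl.
  move=> i _; rewrite /d (@trunc_log_eq 4 j)//.
  by have := p4 j; have := ltn_ord i; rewrite /Q expnS; lia.
have S_ge0 n : 0 <= S n by apply: sumr_ge0.
have S_le n : S n <= n%:R.
  rewrite -[X in _ <= X%:R]card_ord -sumr_const; apply: ler_sum => i _.
  by case: (d i).
have QR j : (Q j)%:R = (4 ^ j)%:R - 1 :> R by rewrite /Q -subn1 natrB.
have p4R j : (4 ^ j.+1)%:R = 4 * (4 ^ j)%:R :> R by rewrite expnS natrM.
have one_le j : 1 <= (4 ^ j)%:R :> R by rewrite ler1n.
exists d; split=> m.
  (* The last stretch before [Q m.*2.+1] consists of zeros and fills at least three quarters of the
     total; the one before [Q m.*2.+2] consists of ones. *)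
  exists (Q m.*2.+1); first by rewrite (leq_trans _ (leQ _))//; lia.
  rewrite -/(S _) SS odd_double mulr0 addr0 QR p4R.
  by have := S_le (Q m.*2); rewrite QR; have := one_le m.*2; lra.
exists (Q m.*2.+2); first by rewrite (leq_trans _ (leQ _))//; lia.
rewrite -/(S _) SS /= odd_double mulr1 QR p4R natrM.
by have := S_ge0 (Q m.*2.+1); have := one_le m.*2.+1; lra.
Qed.

Lemma oscillating_cantor_digits (R : realType) (l p delta : R)
    (nu : probability R R) (N k M : nat) :
  0 < l < 1 -> 0 < p < 1 / 2 -> bernoulli_convolution l p nu -> 0 < delta ->
  (0 < N)%N -> (0 < M)%N ->
  (forall b, gapped l delta (concat_words N k b)) ->
  exists d, forall f,
    (lower_local_dim nu (expansion l (cantor_digits N k M d f)) <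
     upper_local_dim nu (expansion l (cantor_digits N k M d f)))%E.
Proof.
move=> hl hp hnu d0 N0 M0 gap.
have hp1 : 0 < p < 1 by lra.
have D0 : 0 < ln (1 - p) - ln p by rewrite subr_gt0 ltr_ln ?posrE; lra.
pose B := (M.+2 * (N + k.*2))%N.
have B0 : (0 < B)%N by rewrite /B muln_gt0/=; lia.
have BR : 0 < B%:R :> R by rewrite ltr0n.
have NM0 : 0 < (N * M)%:R :> R by rewrite ltr0n muln_gt0 N0.
have [d [dlo dhi]] := exists_oscillating_frequency R.
exists d => f.
pose c := (M.+2 * k + N)%:R * (ln p + ln (1 - p)) : R.
(* The growth rate of [log_mass] per digit when [d] has frequency of ones [x]. *)
pose h (x : R) := (c + (N * M)%:R * (ln p + x * (ln (1 - p) - ln p))) / B%:R.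
have hE Q x : (Q * B)%:R * h x =
    Q%:R * c + (N * M)%:R * (Q%:R * ln p + Q%:R * x * (ln (1 - p) - ln p)).
  rewrite natrM -mulrA [B%:R * _]mulrC /h divfK ?gt_eqF//; ring.
apply: (@oscillating_local_dim R l p delta (h (1 / 3)) (h (2 / 3))) => //.
- exact: gap.
- by rewrite /h ltr_pM2r ?invr_gt0// ltrD2l ltr_pM2l// ltrD2l ltr_pM2r//; lra.
- move=> m; have [Q mQ hQ] := dlo m; exists (Q * B)%N.
    by rewrite (leq_trans mQ)// leq_pmulr.
  rewrite log_mass_cantor_digits digit_weight_sum hE -/c lerD2l ler_pM2l//.
  by rewrite lerD2l ler_pM2r//; lra.
- move=> m; have [Q mQ hQ] := dhi m; exists (Q * B)%N.
    by rewrite (leq_trans mQ)// leq_pmulr.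
  rewrite log_mass_cantor_digits digit_weight_sum hE -/c lerD2l ler_pM2l//.
  by rewrite lerD2l ler_pM2r.
Qed.

(** As [k] grows, [top_tail 1 k] tends to [e], which is 1(10)^oo = 11(01)^oo and has value below 1
    by hypothesis. *)
Lemma top_tail_lt1_large (R : realType) (l : R) : 0 < l < 1 ->
  l + l ^+ 2 / (1 - l ^+ 2) < 1 ->
  exists2 k, (0 < k)%N & expansion l (top_tail 1 k) < 1.
Proof.
move=> /[dup] hl /andP[l0 l1] h.
have l2 : 0 < 1 - l ^+ 2 by nra.
pose e i := (i < 1)%N || ~~ odd (i - 1).
have eE : expansion l e = l + l ^+ 2 / (1 - l ^+ 2).
  pose x := expansion l (tailn 1 e).
  have tE : tailn 1 (tailn 1 (tailn 1 e)) = tailn 1 e.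
    by apply/funext => i; rewrite /tailn /e; lia.
  have xE : x = l * (1 + l * x).
    by rewrite {1}/x expansionE// (expansionE (tailn 1 (tailn 1 e)))// tE add0r.
  have -> : expansion l e = l * (1 + x) by rewrite expansionE.
  have -> : x = l / (1 - l ^+ 2).
    apply: (@mulIf _ (1 - l ^+ 2)); first by rewrite gt_eqF.
    by rewrite divfK ?gt_eqF//; move: xE; move: (x) => y; lra.
  by ring.
rewrite -eE in h.
pose K := l / (1 - l).
have K0 : 0 < K by rewrite divr_gt0//; lra.
have [k hk] : exists k, K * l ^+ k < 1 - expansion l e.
  have := @cvg_geometric R K l; rewrite gtr0_norm// => /(_ l1).
  have pos : 0 < 1 - expansion l e by lra.
  move=> /cvgr_lt /(_ _ pos) [m _ /(_ m (leqnn m))] /=.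
  by exists m.
exists k.+1 => //.
have := @expansion_prefix R l (top_tail 1 k.+1) e k hl.
have agree i : (i < k)%N -> top_tail 1 k.+1 i = e i.
  by move=> ik; rewrite /top_tail /e; lia.
move=> /(_ agree); rewrite mulrC -/K ler_norml => /andP[_]; lra.
Qed.

(** The sequence is 1^(N+1) 0 1^oo, of value [l / (1 - l) - l ^+ N.+2]. The hypothesis says that
    [l / (1 - l)] exceeds 1 by less than [(1 / 2) ^+ N.+2]. *)
Lemma top_tail_lt1_near_half (R : realType) (l : R) (N : nat) : (0 < N)%N ->
  1 / 2 <= l -> l * (2 + (1 / 2) ^+ N.+2) < 1 + (1 / 2) ^+ N.+2 ->
  expansion l (top_tail N 1) < 1.
Proof.
move=> N0 l2 h.
have e0 : 0 < (1 / 2 : R) ^+ N.+2 by rewrite exprn_gt0//; lra.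
have l1 : l < 1 by nra.
have hl : 0 < l < 1 by lra.
have single m : expansion l (fun i => i == m) = l ^+ m.+1.
  elim: m => [|m IH].
    rewrite expansionE//= (_ : tailn 1 _ = fun=> false).
      by rewrite expansion_false// addr0 mulr1.
    by apply/funext => i.
  rewrite expansionE// (_ : tailn 1 _ = fun i => i == m).
    by rewrite IH add0r -exprS.
  by apply/funext => i.
have -> : top_tail N 1 = flip (fun i => i == N.+1).
  by apply/funext => i; rewrite /top_tail /flip; lia.
rewrite expansion_flip// single.
have : (1 / 2) ^+ N.+2 <= l ^+ N.+2 by rewrite lerXn2r// nnegrE; lra.
have : l / (1 - l) < 1 + (1 / 2) ^+ N.+2 by rewrite ltr_pdivrMr; lra.
by lra.
Qed.

(** * The local dimension spectrum *)

Lemma log_mass_discrepancy (R : realType) (p : R) (a : nat -> bool) n :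
  log_mass p a n - n%:R * ((ln p + ln (1 - p)) / 2) =
  discrepancy R a n * ((ln (1 - p) - ln p) / 2).
Proof.
elim: n => [|n IH].
  by rewrite /log_mass /discrepancy !big_ord0 !mul0r subr0.
rewrite discrepancyS [RHS]mulrDl -IH /log_mass big_ord_recr/= /digit_weight mulrSr.
by case: (a n); field.
Qed.

Lemma local_dim_beta1_golden (R : realType) (beta1 p l : R)
    (nu : probability R R) (x : R) :
  is_beta1 beta1 -> 0 < p < 1 / 2 -> beta1^-1 < l < golden R ->
  bernoulli_convolution l p nu -> Atilde l x -> x != 0 -> x != l / (1 - l) ->
  has_local_dim nu x ((ln p + ln (1 - p)) / (2 * ln l)).
Proof.
move=> hb hp /andP[bl lg] hnu [delta /= d0 hx] x0 xK.
have b0 : 0 < beta1^-1 by rewrite invr_gt0; case: hb.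
have lg2 : l + l ^+ 2 < 1 by apply: lt_golden; rewrite lg; lra.
have l1 : l < 1 by nra.
have h1 : 1 <= l + l ^+ 2 / (1 - l ^+ 2).
  by apply: (beta1_lt_ge1 hb); rewrite bl.
have l2 : 1 / 2 < l.
  rewrite ltNge; apply/negP => l2.
  suff : l ^+ 2 / (1 - l ^+ 2) < 1 / 2 by lra.
  by rewrite ltr_pdivrMr; nra.
have hl : 0 < l < 1 by lra.
have lnl : ln l != 0 by rewrite lt_eqF// ln_lt0.
have [|a xa ga] := univoque_away_gapped _ d0 hx; first by rewrite l2.
(* Constant digits would give one of the two excluded end points. *)
have [m am] : exists m, a m != a m.+1.
  apply: contrapT => h.
  have cst n : a n = a 0%N.
    elim: n => // n <-; apply/esym/eqP; apply: contrapT => /negP an.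
    by apply: h; exists n.
  have aE : a = fun=> a 0%N by apply/funext.
  move: x0 xK; rewrite xa aE; case: (a 0%N).
    by rewrite expansion_true// eqxx.
  by rewrite expansion_false// eqxx.
have [C hC] := discrepancy_bounded hl lg2 h1 d0 ga am.
rewrite xa; apply: (@local_dim_of_bounded R l p delta _
  (C * `|(ln (1 - p) - ln p) / 2|)) => //; first lra.
move=> n; have -> : (ln p + ln (1 - p)) / (2 * ln l) * ln l =
    (ln p + ln (1 - p)) / 2 by field.
by rewrite log_mass_discrepancy normrM ler_wpM2r.
Qed.

(* The frequency of zeros in [cantor_digits N k N d f] when [d] is constantly
   true; it is the lowest possible one. *)
Definition frequency (R : realType) (N k : nat) : R :=
  (N.+2 * k + N)%:R / (N.+2 * (N + k.*2))%:R.

Definition frequencies (R : realType) (l : R) : set R :=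
  [set x | exists N k, [/\ (0 < N)%N, (0 < k)%N,
     expansion l (top_tail N k) < 1 & x = frequency R N k]].

Lemma frequencies_itv (R : realType) (l x : R) : frequencies l x ->
  0 < x < 1 / 2.
Proof.
move=> [N [k [N0 k0 _ ->]]]; rewrite /frequency.
have d0 : 0 < (N.+2 * (N + k.*2))%:R :> R by rewrite ltr0n muln_gt0/=; lia.
rewrite divr_gt0//= ?ltr_pdivrMr// ?ltr0n; last by nia.
have : (2 * (N.+2 * k + N))%:R < (N.+2 * (N + k.*2))%:R :> R.
  by rewrite ltr_nat; nia.
by rewrite natrM; lra.
Qed.

Lemma frequencies_lbound (R : realType) (l : R) : lbound (frequencies l) 0.
Proof. by move=> x /frequencies_itv; lra. Qed.

Lemma inf_frequencies_ge0 (R : realType) (l : R) : 0 <= inf (frequencies l).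
Proof.
have [->|ne] := eqVneq (frequencies l) set0; first by rewrite inf0.
by apply: lb_le_inf; [exact/set0P|exact: frequencies_lbound].
Qed.

Lemma inf_frequencies_le (R : realType) (l x : R) : frequencies l x ->
  inf (frequencies l) <= x.
Proof. by apply: ge_inf; exists 0; exact: frequencies_lbound. Qed.

(* The infimum itself need not be admissible; the second term moves strictly above
   it, stays below 1/2, and keeps the bound monotone and small near 1/2. *)
Definition freq_bound (R : realType) (l : R) : R :=
  inf (frequencies l) + (1 / 2 - inf (frequencies l)) * (l - 1 / 2).

Lemma below_beta1 (R : realType) (beta1 l : R) : is_beta1 beta1 ->
  1 / 2 < l < beta1^-1 ->
  [/\ 1 / 2 < l < 1, l + l ^+ 2 < 1 & exists k, [/\ (0 < k)%N,
     expansion l (top_tail 1 k) < 1 & frequencies l (frequency R 1 k)]].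
Proof.
move=> hb /andP[l2 lb].
have [|l1 hl] := lt_beta1_lt1 hb (l := l); first lra.
have q0 : 0 < 1 - l ^+ 2 by nra.
have lt1 : l + l ^+ 2 < 1.
  suff : l ^+ 2 <= l ^+ 2 / (1 - l ^+ 2) by lra.
  by rewrite ler_pdivlMr//; nra.
split=> //; first lra.
have [|k k0 hk] := top_tail_lt1_large _ hl; first lra.
by exists k; split => //; exists 1%N, k.
Qed.

Lemma freq_bound_itv (R : realType) (beta1 l : R) : is_beta1 beta1 ->
  1 / 2 < l < beta1^-1 -> inf (frequencies l) < freq_bound l < 1 / 2.
Proof.
move=> hb hl; have [/andP[l2 l1] _ [k [k0 hk fk]]] := below_beta1 hb hl.
have := inf_frequencies_le fk; have := frequencies_itv fk.
by rewrite /freq_bound; move: (inf _) => i; nra.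
Qed.

(** Words admissible for [l'] are admissible for a smaller [l], so the infimum is nondecreasing;
    [freq_bound] increases in both the infimum and [l]. *)
Lemma freq_bound_nondecreasing (R : realType) (beta1 : R) : is_beta1 beta1 ->
  {in `]1 / 2, beta1^-1[ &, {homo @freq_bound R : l l' / l <= l'}}.
Proof.
move=> hb l l'; rewrite !in_itv /= => hl hl' ll'.
have [/andP[l2 l1] _ [k [_ _ fk]]] := below_beta1 hb hl.
have [/andP[l2' l1'] _ [k' [_ _ fk']]] := below_beta1 hb hl'.
have le : inf (frequencies l) <= inf (frequencies l').
  apply: lb_le_inf; first by exists (frequency R 1 k').
  move=> x [N [n [N0 n0 adm ->]]]; apply: inf_frequencies_le.
  exists N, n; split=> //; apply: le_lt_trans adm.
  by apply: le_expansion => //; lra.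
have := inf_frequencies_le fk'; have := frequencies_itv fk'.
by rewrite /freq_bound; move: (inf _) (inf _) le => i i'; nra.
Qed.

Lemma freq_bound_cvg (R : realType) :
  @freq_bound R l @[l --> (1 / 2)^'+] --> (0 : R).
Proof.
apply/cvgrPdist_le => e e0.
(* With [k = 1] the frequency is at most [2 / N.+2%:R], which this choice makes smaller than
   [e / 2]. *)
pose N := (Num.truncn (4 / e)).+1.
have Ne : 4 / e < N.+2%:R.
  by apply: lt_trans (truncnS_gt _) _; rewrite ltr_nat leqnSn.
pose z : R := (1 / 2) ^+ N.+2.
have z0 : 0 < z by rewrite exprn_gt0//; lra.
near=> l.
have l2 : 1 / 2 < l by near: l; exact: nbhs_right_gt.
have le2 : l < 1 / 2 + e / 2.
  by near: l; apply: nbhs_right_lt; rewrite ltrDl divr_gt0.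
have l1 : l < 1 by near: l; apply: nbhs_right_lt; lra.
have lz : l < (1 + z) / (2 + z).
  near: l; apply: nbhs_right_lt; rewrite ltr_pdivlMr; lra.
have fN : frequencies l (frequency R N 1).
  exists N, 1%N; split=> //; apply: top_tail_lt1_near_half => //.
  by rewrite -/z -ltr_pdivlMr//; lra.
have fNe : frequency R N 1 <= e / 2.
  have d0 : 0 < (N.+2 * (N + 1.*2))%:R :> R by rewrite ltr0n muln_gt0/=; lia.
  rewrite /frequency ler_pdivrMr//.
  have : (N.+2 * 1 + N)%:R <= 2 * N.+2%:R :> R.
    by rewrite -natrM ler_nat; lia.
  have -> : (N.+2 * (N + 1.*2))%:R = N.+2%:R * N.+2%:R :> R.
    by rewrite -natrM; congr _%:R; lia.
  have := Ne; rewrite ltr_pdivrMr//; move: (N.+2%:R) (ltr0Sn R N.+1) => y; nra.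
have := inf_frequencies_le fN; have := inf_frequencies_ge0 l.
have := frequencies_itv fN.
rewrite sub0r normrN /freq_bound; move: (inf _) => i h1 h2 h3.
by rewrite ger0_norm; nra.
Unshelve. all: by end_near.
Qed.

(** Since [freq_bound l] exceeds the infimum, some admissible frequency lies below it, and the range
    of dimensions of the corresponding words contains [g]. *)
Lemma spectrum_dim_gt0 (R : realType) (beta1 p l g : R) (nu : probability R R) :
  is_beta1 beta1 -> 0 < p < 1 / 2 -> 1 / 2 < l < beta1^-1 ->
  bernoulli_convolution l p nu ->
  (freq_bound l * ln p + (1 - freq_bound l) * ln (1 - p)) / ln l <= g <=
    ((1 - freq_bound l) * ln p + freq_bound l * ln (1 - p)) / ln l ->
  (0 < hausdorff_dim [set x | Atilde l x /\ has_local_dim nu x g])%E.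
Proof.
move=> hb hp hl hnu.
have [hl1 l2 [k [_ _ fk]]] := below_beta1 hb hl.
have /andP[l12 l1] := hl1; have l01 : 0 < l < 1 by lra.
have /andP[rlo rhi] := freq_bound_itv hb hl.
have [_ [N [n [N0 n0 adm ->]]] lt_r] := inf_lt (ex_intro _ _ fk) rlo.
have [delta d0 gap] := gapped_concat_words l01 l2 N0 n0 adm.
have lnl : ln l < 0 by rewrite ln_lt0.
have lnp : ln p < ln (1 - p) by rewrite ltr_ln ?posrE; lra.
rewrite ler_ndivrMr// ler_ndivlMr// => hg.
have [|d hd] := @local_dim_cantor_digits R l p delta g nu N n N l01 hp hnu d0 N0 N0 gap.
  rewrite ler_ndivrMr// ler_ndivlMr//; move: hg lt_r.
  rewrite -/(frequency R N n); move: (frequency R N n) => rho; nra.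
apply: (cantor_family_dim (N := N) (k := n) (M := N) (d := d) l01 d0) => // f.
split=> //; exists delta => //=.
by apply: gapped_univoque_away => //; exact: gap.
Qed.

Lemma oscillating_dim_gt0 (R : realType) (beta1 p l : R)
    (nu : probability R R) :
  is_beta1 beta1 -> 0 < p < 1 / 2 -> 1 / 2 < l < beta1^-1 ->
  bernoulli_convolution l p nu ->
  (0 < hausdorff_dim [set x | Atilde l x /\
         (lower_local_dim nu x < upper_local_dim nu x)%E])%E.
Proof.
move=> hb hp hl hnu.
have [hl1 l2 [k [k0 adm _]]] := below_beta1 hb hl.
have /andP[l12 l1] := hl1; have l01 : 0 < l < 1 by lra.
have [delta d0 gap] := gapped_concat_words l01 l2 (ltn0Sn 0) k0 adm.
have [d hd] := oscillating_cantor_digits l01 hp hnu d0 (ltn0Sn 0) (ltn0Sn 0) gap.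
apply: (cantor_family_dim (N := 1) (k := k) (M := 1) (d := d) l01 d0) => // f.
split=> //; exists delta => //=.
by apply: gapped_univoque_away => //; exact: gap.
Qed.
(* In the first part the end points 0 and l / (1 - l) of Ilam l are excluded:
   they belong to Atilde l, but the local dimensions there are
   ln p / ln l and ln (1 - p) / ln l. *)
Theorem theorem1p8 (R : realType) (beta1 p : R)
    (hbeta1 : is_beta1 beta1) (hp : 0 < p < 1 / 2) :
  [/\ forall l : R, beta1^-1 < l < golden R ->
        forall nu : probability R R, bernoulli_convolution l p nu ->
        forall x : R, Atilde l x -> x != 0 -> x != l / (1 - l) ->
          has_local_dim nu x ((ln p + ln (1 - p)) / (2 * ln l)),
      exists r : R -> R,
        [/\ forall l : R, 1 / 2 < l < beta1^-1 ->
              0 < r l < 1 / 2 /\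
              forall nu : probability R R, bernoulli_convolution l p nu ->
              forall gamma : R,
                (r l * ln p + (1 - r l) * ln (1 - p)) / ln l <= gamma <=
                  ((1 - r l) * ln p + r l * ln (1 - p)) / ln l ->
                (0 < hausdorff_dim
                       [set x | Atilde l x /\ has_local_dim nu x gamma])%E,
            {in `]1 / 2, beta1^-1[ &, {homo r : l l' / l <= l'}} &
            r l @[l --> (1 / 2)^'+] --> (0 : R)] &
      forall l : R, 1 / 2 < l < beta1^-1 ->
        forall nu : probability R R, bernoulli_convolution l p nu ->
        (0 < hausdorff_dim
               [set x | Atilde l x /\
                 (lower_local_dim nu x < upper_local_dim nu x)%E])%E].
Proof.
split.
- by move=> l hl nu hnu x; apply: (local_dim_beta1_golden hbeta1 hp hl hnu).
- exists (@freq_bound R); split.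
  + move=> l hl; have /andP[r0 r1] := freq_bound_itv hbeta1 hl.
    split; first by rewrite r1 (le_lt_trans (inf_frequencies_ge0 l) r0).
    move=> nu hnu g hg; exact: (spectrum_dim_gt0 hbeta1 hp hl hnu hg).
  + exact: freq_bound_nondecreasing.
  + exact: freq_bound_cvg.
- by move=> l hl nu hnu; exact: (oscillating_dim_gt0 hbeta1 hp hl hnu).
Qed.
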